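(* Let $\Gamma$ be a Coxeter graph of small type with no triangle, with finite vertex set $S$. The representation $\psi:G_\Gamma^+\to\mathrm{Gl}(V)$, $\sigma_s\mapsto\psi_s$, where $\psi_s(e_\beta)=\varphi_s(e_\beta)+x\,T(s,\beta)\cdot e_{\alpha_s}$ with the polynomials $T(s,\beta)$ and the maps $\varphi_s$ defined in the context, is faithful (i.e. $\psi$ is injective).
   Context: A Coxeter graph $\Gamma$ encodes a Coxeter matrix $(m_{s,t})_{s,t\in S}$ over a finite set $S$ ($m_{s,s}=1$, $m_{s,t}=m_{t,s}\in\{2,3,\dots,+\infty\}$ for $s\ne t$). $\Gamma$ is of small type if $m_{s,t}\in\{2,3\}$ for all $s\neq t$; it has no triangle if there is no triple $\{s,t,r\}$ in $S$ with $m_{s,t},m_{s,r},m_{t,r}\ge 3$. The Artin monoid $G_\Gamma^+$ is the monoid presented by generators $\sigma_s$ ($s\in S$) and, in the small type case, relations $\sigma_s\sigma_t=\sigma_t\sigma_s$ if $m_{s,t}=2$ and $\sigma_s\sigma_t\sigma_s=\sigma_t\sigma_s\sigma_t$ if $m_{s,t}=3$. Root system: let $U$ be the real vector space with basis $\Pi=\{\alpha_s;s\in S\}$ and $\langle\ ,\ \rangle$ the symmetric bilinear form with $\langle\alpha_s,\alpha_t\rangle=-2\cos(\pi/m_{s,t})$ (so it is $2$ if $s=t$, $0$ if $m_{s,t}=2$, $-1$ if $m_{s,t}=3$). The Coxeter group $W=\langle S\mid s^2=1,\ (st)^{m_{s,t}}=1\rangle$ acts on $U$ by $s(u)=u-\langle\alpha_s,u\rangle\alpha_s$.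 The root system is $\Phi=\{w\alpha_s;s\in S,w\in W\}$, $\Phi^+$ is the set of roots that are nonnegative combinations of the $\alpha_s$, and $\Phi^-=-\Phi^+$. With $l$ the word length on $W$ with respect to $S$, the depth of $\beta\in\Phi^+$ is $\mathrm{dp}(\beta)=\min\{l(w); w\in W,\ w\beta\in\Phi^-\}$. For small type, $\langle\beta,\gamma\rangle\in\mathbb{Z}$ for all roots. Let $\mathbb{K}=\mathbb{Q}(x,y)$, and $V$ the $\mathbb{K}$-vector space with basis $\{e_\beta;\beta\in\Phi^+\}$. For $s\in S$ the linear map $\varphi_s:V\to V$ is defined by $$\varphi_s(e_\beta)=\begin{cases}0&\text{if }\beta=\alpha_s\\ e_\beta&\text{if }\langle\alpha_s,\beta\rangle=0\\ y\cdot e_{\beta-a\alpha_s}&\text{if }\langle\alpha_s,\beta\rangle=a>0,\ \beta\ne\alpha_s\\ (1-y)\cdot e_\beta+e_{\beta+a\alpha_s}&\text{if }\langle\alpha_s,\beta\rangle=-a<0.\end{cases}$$ The polynomials $T(s,\beta)\in\mathbb{Q}[y]$ ($s\in S$, $\beta\in\Phi^+$) are defined by induction on $\mathrm{dp}(\beta)$. If $\mathrm{dp}(\beta)=1$, then $\beta=\alpha_t$ for some $t\in S$, and $T(s,\alpha_t)=y^2$ if $t=s$, $T(s,\alpha_t)=0$ if $t\ne s$. If $\mathrm{dp}(\beta)\ge2$, choose $t\in S$ with $\mathrm{dp}(t\cdot\beta)=\mathrm{dp}(\beta)-1$ (such $t$ exists); then $b:=\langle\alpha_t,\beta\rangle>0$,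 and: - if $\langle\alpha_s,\beta\rangle>0$: $T(s,\beta)=y^{\mathrm{dp}(\beta)}(y-1)$; - if $\langle\alpha_s,\beta\rangle=0$ and $\langle\alpha_s,\alpha_t\rangle=0$: $T(s,\beta)=y\,T(s,\beta-b\alpha_t)$; - if $\langle\alpha_s,\beta\rangle=0$ and $\langle\alpha_s,\alpha_t\rangle=-1$: $T(s,\beta)=(y-1)T(s,\beta-b\alpha_t)+y\,T(t,\beta-b\alpha_s-b\alpha_t)$; - if $\langle\alpha_s,\beta\rangle=-a<0$ and $\langle\alpha_s,\alpha_t\rangle=0$: $T(s,\beta)=y\,T(s,\beta-b\alpha_t)$; - if $\langle\alpha_s,\beta\rangle=-a<0$, $\langle\alpha_s,\alpha_t\rangle=-1$ and $b>a$: $T(s,\beta)=(y-1)T(s,\beta-b\alpha_t)+y\,T(t,\beta-(b-a)\alpha_s-b\alpha_t)$; - if $\langle\alpha_s,\beta\rangle=-a<0$, $\langle\alpha_s,\alpha_t\rangle=-1$ and $b=a$: $T(s,\beta)=T(t,\beta-b\alpha_t)+(y-1)T(s,\beta-b\alpha_t)$; - if $\langle\alpha_s,\beta\rangle=-a<0$, $\langle\alpha_s,\alpha_t\rangle=-1$ and $b<a$: $T(s,\beta)=y\,T(s,\beta-b\alpha_t)+T(t,\beta-b\alpha_t)+y^{\mathrm{dp}(\beta)-1}(1-y)$. The definition is independent of the choices of $t$, each $\psi_s$ is invertible, and $\sigma_s\mapsto\psi_s$ does induce a monoid homomorphism $\psi:G_\Gamma^+\to\mathrm{Gl}(V)$.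 *)

(* Defs.v *)
From HB Require Import structures.
From mathcomp Require Import all_boot all_order all_algebra.
From mathcomp Require Import boolp reals trigo.
From mathcomp Require Import freeg.
From mathcomp Require Import ring lra.

Set Implicit Arguments.
Unset Strict Implicit.
Unset Printing Implicit Defensive.

Import Order.TTheory GRing.Theory Num.Theory.

Local Open Scope quotient_scope.
Local Open Scope ring_scope.

(* The least n satisfying P; by convention 0 if there is none. *)
Definition least (P : nat -> Prop) : nat :=
  if pselect (exists n, `[< P n >]) is left ex then ex_minn ex else 0%N.

Section PresentedMonoid.
Variables (S : choiceType) (rel : seq S -> seq S -> Prop).

Inductive congruent : seq S -> seq S -> Prop :=
| congruent_rel u v of rel u v : congruent u v
| congruent_refl u : congruent u u
| congruent_sym u v of congruent u v : congruent v u
| congruent_trans v u w of congruent u v & congruent v w : congruent u w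
| congruent_cat u u' v v' of congruent u u' & congruent v v' :
    congruent (u ++ v) (u' ++ v').

Definition congruentb (u v : seq S) : bool := `[< congruent u v >].

Lemma congruentb_refl : reflexive congruentb.
Proof. by move=> u; apply/asboolP; exact: congruent_refl. Qed.

Lemma congruentb_sym : symmetric congruentb.
Proof. by move=> u v; apply/asboolP/asboolP => /congruent_sym. Qed.

Lemma congruentb_trans : transitive congruentb.
Proof.
move=> v u w /asboolP uv /asboolP vw; apply/asboolP.
exact: congruent_trans uv vw.
Qed.

Canonical congruentb_equiv :=
  EquivRel congruentb congruentb_refl congruentb_sym congruentb_trans.

(* The monoid presented by the generators S and the relations rel. *)
Definition presented := {eq_quot congruentb}.
HB.instance Definition _ := Choice.on presented.
HB.instance Definition _ := EqQuotient.on presented.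

Definition word (u : seq S) : presented := \pi_presented u.

Lemma wordP u v : word u = word v <-> congruent u v.
Proof.
split=> [/eqP|uv]; first by rewrite piE => /asboolP.
by apply/eqP; rewrite piE; apply/asboolP.
Qed.

Lemma word_repr x : word (repr x) = x.
Proof. exact: reprK. Qed.

Lemma repr_word u : congruent (repr (word u)) u.
Proof. by apply/wordP; rewrite word_repr. Qed.

Definition presented_mul (x y : presented) : presented :=
  word (repr x ++ repr y).

Lemma presented_mulA : associative presented_mul.
Proof.
move=> x y z; apply/wordP.
apply: (@congruent_trans (repr x ++ (repr y ++ repr z))).
  by apply: congruent_cat; [exact: congruent_refl | exact: repr_word].
rewrite catA; apply: congruent_cat; last exact: congruent_refl.
exact/congruent_sym/repr_word.
Qed.

Lemma presented_mul1 : left_id (word [::]) presented_mul.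
Proof.
move=> x; rewrite -[RHS]word_repr; apply/wordP.
rewrite -[X in congruent _ X]cat0s.
by apply: congruent_cat; [exact: repr_word | exact: congruent_refl].
Qed.

Lemma presented_mulr1 : right_id (word [::]) presented_mul.
Proof.
move=> x; rewrite -[RHS]word_repr; apply/wordP.
rewrite -[X in congruent _ X]cats0.
by apply: congruent_cat; [exact: congruent_refl | exact: repr_word].
Qed.

HB.instance Definition _ := isMonoid.Build presented
  presented_mulA presented_mul1 presented_mulr1.

End PresentedMonoid.
Arguments word {S} rel u.

Section GeneralLinear.
Variables (K : fieldType) (V : lmodType K).

Record GL := MkGL {
  GL_fun :> V -> V;
  GL_linear : linear GL_fun;
  GL_bij : bijective GL_fun }.

HB.instance Definition _ := gen_eqMixin GL.
HB.instance Definition _ := gen_choiceMixin GL.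

Lemma GL_eq (f g : GL) : f =1 g -> f = g.
Proof.
case: f g => [f lf bf] [g lg bg] /= /funext fg; case: _ / fg lg bg => lg bg.
by rewrite (Prop_irrelevance lf lg) (Prop_irrelevance bf bg).
Qed.

Lemma GL_one_linear : linear (@id V).
Proof. by []. Qed.

Definition GL_one : GL := MkGL GL_one_linear (Bijective (frefl _) (frefl _)).

Lemma GL_mul_linear (f g : GL) : linear (f \o g).
Proof. by move=> a u v /=; rewrite !GL_linear. Qed.

Definition GL_mul (f g : GL) : GL :=
  MkGL (GL_mul_linear f g) (bij_comp (GL_bij f) (GL_bij g)).

Lemma GL_mulA : associative GL_mul.
Proof. by move=> f g h; apply: GL_eq. Qed.

Lemma GL_mul1 : left_id GL_one GL_mul.
Proof. by move=> f; apply: GL_eq. Qed.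

Lemma GL_mulr1 : right_id GL_one GL_mul.
Proof. by move=> f; apply: GL_eq. Qed.

HB.instance Definition _ := isMonoid.Build GL GL_mulA GL_mul1 GL_mulr1.

End GeneralLinear.

(* The value 0 encodes m s t = +oo. *)
Record coxeterMatrix (S : finType) := CoxeterMatrix {
  cox_entry :> S -> S -> nat;
  cox_diag : forall s, cox_entry s s = 1%N;
  cox_sym : forall s t, cox_entry s t = cox_entry t s;
  cox_offdiag : forall s t, s != t -> cox_entry s t != 1%N }.

Section Coxeter.
Variables (S : finType) (M : coxeterMatrix S).

Definition small_type : Prop :=
  forall s t, s != t -> M s t = 2%N \/ M s t = 3%N.

Definition edge (s t : S) : bool := (M s t == 0)%N || (3 <= M s t)%N.

Definition no_triangle : Prop :=
  ~ exists s t r, [/\ edge s t, edge s r & edge t r].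

(* The word s t s ... with n letters. *)
Definition alternating (s t : S) (n : nat) : seq S :=
  mkseq (fun i => if odd i then t else s) n.

(* If m s t is infinite, i.e. 0, the relation is the trivial [::] = [::]. *)
Inductive artin_rel : seq S -> seq S -> Prop :=
| ArtinRel s t : artin_rel (alternating s t (M s t)) (alternating t s (M s t)).

Definition artin_monoid := presented artin_rel.
HB.instance Definition _ := monoid.Monoid.on artin_monoid.

Definition sigma (s : S) : artin_monoid := word artin_rel [:: s].

Inductive coxeter_rel : seq S -> seq S -> Prop :=
| CoxeterInvol s : coxeter_rel [:: s; s] [::]
| CoxeterBraid s t : coxeter_rel (flatten (nseq (M s t) [:: s; t])) [::].

(* Since the generators are involutions, this monoid presentation is also the
   group presentation. *)
Definition coxeter_group := presented coxeter_rel.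
HB.instance Definition _ := monoid.Monoid.on coxeter_group.

Definition cox_length (w : coxeter_group) : nat :=
  least (fun n => exists2 u : seq S, size u = n & word coxeter_rel u = w).

Variable R : realType.

(* The vector u is the combination \sum_s u s *: simple_root s. *)
Definition rootspace := {ffun S -> R^o}.
HB.instance Definition _ := GRing.Lmodule.on rootspace.

Definition simple_root (s : S) : rootspace := [ffun t => (t == s)%:R].

(* If m s t is infinite, then pi / 0 = 0 and the value is -2, as it should be. *)
Definition basis_form (s t : S) : R := - 2 * cos (pi / (M s t)%:R).

Definition form (u v : rootspace) : R :=
  \sum_s \sum_t u s * v t * basis_form s t.

Definition reflection (s : S) (u : rootspace) : rootspace :=
  u - form (simple_root s) u *: simple_root s.

Lemma form_simple_rootl (s : S) (u : rootspace) :
  form (simple_root s) u = \sum_t u t * basis_form s t.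
Proof.
rewrite /form (bigD1 s) //= [X in _ + X]big1 => [|r /negPf rs].
  by rewrite addr0; apply: eq_bigr => t _; rewrite ffunE eqxx mul1r.
by rewrite big1 // => t _; rewrite ffunE rs !mul0r.
Qed.

Lemma form_simple_root (s t : S) :
  form (simple_root s) (simple_root t) = basis_form s t.
Proof.
rewrite form_simple_rootl (bigD1 t) //= ffunE eqxx mul1r big1 ?addr0 //.
by move=> r /negPf rt; rewrite ffunE rt mul0r.
Qed.

Lemma form_subZ (s t : S) (a : R) (u : rootspace) :
  form (simple_root s) (u - a *: simple_root t) =
  form (simple_root s) u - a * basis_form s t.
Proof.
rewrite -form_simple_root !form_simple_rootl mulr_sumr -sumrB.
by apply: eq_bigr => r _; rewrite !ffunE mulrBl -mulrA.
Qed.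

Lemma cos_pi3 : cos (pi / 3) = 2^-1 :> R.
Proof.
have pi0 : 0 < pi :> R := pi_gt0 R.
have : cos (pi / 3 + (pi / 3 + pi / 3)) = - 1 :> R.
  by rewrite -cospi; congr cos; field.
have s2 := cos2Dsin2 (pi / 3 : R).
have c0 : 0 < cos (pi / 3) :> R.
  by apply: cos_gt0_pihalf; apply/andP; split; lra.
rewrite !cosD sinD; move: (cos _) (sin _) s2 c0 => c z s2 c0 E.
have : (c + 1) * (2 * c - 1) ^+ 2 = 0.
  have -> : (c + 1) * (2 * c - 1) ^+ 2 = 4 * c ^+ 3 - 3 * c + 1 by ring.
  have s2c : c * (c ^+ 2 + z ^+ 2) = c by rewrite s2 mulr1.
  by lra.
move/eqP; rewrite mulf_eq0 expf_eq0 /= => /orP[] /eqP ?; lra.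
Qed.

Lemma basis_form1 (s : S) : basis_form s s = 2.
Proof. by rewrite /basis_form cox_diag divr1 cospi; ring. Qed.

Lemma basis_form2 (s t : S) : M s t = 2%N -> basis_form s t = 0.
Proof. by rewrite /basis_form => ->; rewrite cos_pihalf mulr0. Qed.

Lemma basis_form3 (s t : S) : M s t = 3%N -> basis_form s t = -1.
Proof. by rewrite /basis_form => ->; rewrite cos_pi3; field. Qed.

Lemma reflectionK (s : S) : involutive (reflection s).
Proof.
move=> u; rewrite {1}/reflection form_subZ basis_form1 /reflection.
by apply/ffunP => r; rewrite !ffunE /GRing.scale /=; ring.
Qed.

Lemma foldr_reflection_congruent (u v : seq S) (x : rootspace) :
  small_type -> congruent coxeter_rel u v ->
  foldr reflection x u = foldr reflection x v.
Proof.
move=> small uv; elim: uv x => {u v}.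
- move=> u v [s|s t] x; first exact: reflectionK.
  have [->|st] := eqVneq s t; first by rewrite cox_diag /= reflectionK.
  case: (small _ _ st) => m; have mts := m; rewrite cox_sym in mts;
    rewrite m /= /reflection !form_subZ !basis_form1.
  + rewrite !(basis_form2 m) !(basis_form2 mts).
    by apply/ffunP => r; rewrite !ffunE /GRing.scale /=; ring.
  + rewrite !(basis_form3 m) !(basis_form3 mts).
    by apply/ffunP => r; rewrite !ffunE /GRing.scale /=; ring.
- by [].
- by move=> u v _ IH x; rewrite IH.
- by move=> u v w _ IH1 _ IH2 x; rewrite IH1 IH2.
- by move=> u u' v v' _ IH1 _ IH2 x; rewrite !foldr_cat IH2 IH1.
Qed.

(* The choice of the word representing w is immaterial: see cox_act_word. *)
Definition cox_act (w : coxeter_group) (u : rootspace) : rootspace :=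
  foldr reflection u (repr w).

Lemma cox_act_word (v : seq S) (u : rootspace) :
  small_type -> cox_act (word coxeter_rel v) u = foldr reflection u v.
Proof. by move=> small; apply: foldr_reflection_congruent (repr_word _ _). Qed.

Definition is_root (u : rootspace) : Prop :=
  exists w s, u = cox_act w (simple_root s).

Definition is_pos_root (u : rootspace) : Prop :=
  is_root u /\ forall s, 0 <= u s.

Definition is_neg_root (u : rootspace) : Prop := is_pos_root (- u).

Definition depth (u : rootspace) : nat :=
  least (fun n => exists2 w, cox_length w = n & is_neg_root (cox_act w u)).

Definition pos_root := {u : rootspace | `[< is_pos_root u >]}.

(* The first argument bounds the recursion depth; depth u is always enough,
   since the recursive calls are at roots of smaller depth. *)
Fixpoint T_rec (n : nat) (s : S) (u : rootspace) : {poly rat} :=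
  if n isn't n'.+1 then 0 else
  if depth u == 1%N then (if u == simple_root s then 'X^2 else 0) else
  if [pick t | depth (reflection t u) == (depth u).-1] is Some t then
    let al := simple_root in
    let a := - form (al s) u in
    let b := form (al t) u in
    if 0 < form (al s) u then 'X^(depth u) * ('X - 1)
    else if form (al s) u == 0 then
      if form (al s) (al t) == 0 then
        'X * T_rec n' s (u - b *: al t)
      else
        ('X - 1) * T_rec n' s (u - b *: al t)
        + 'X * T_rec n' t (u - b *: al s - b *: al t)
    else
      if form (al s) (al t) == 0 then
        'X * T_rec n' s (u - b *: al t)
      else if a < b then
        ('X - 1) * T_rec n' s (u - b *: al t)
        + 'X * T_rec n' t (u - (b - a) *: al s - b *: al t)
      else if b == a then
        T_rec n' t (u - b *: al t) + ('X - 1) * T_rec n' s (u - b *: al t)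
      else
        'X * T_rec n' s (u - b *: al t) + T_rec n' t (u - b *: al t)
        + 'X^((depth u).-1) * (1 - 'X)
  else 0.

(* The variable of {poly rat} is y. *)
Definition T_poly (s : S) (u : rootspace) : {poly rat} := T_rec (depth u) s u.

(* The inner polynomial variable is y and the outer one is x. *)
Definition Qxy : fieldType := {fraction {poly {poly rat}}}.
Definition x_Qxy : Qxy := tofrac 'X.
Definition Qy_to_Qxy (p : {poly rat}) : Qxy := tofrac p%:P.
Definition y_Qxy : Qxy := Qy_to_Qxy 'X.

Definition V : lmodType Qxy := {freeg pos_root / Qxy}.

(* The basis vector indexed by u; it is only used at positive roots, and the
   value 0 at other vectors is a dummy. *)
Definition e_ (u : rootspace) : V :=
  if insub u is Some b then << (b : pos_root) >> else 0.

Definition phi (s : S) : V -> V :=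
  fglift (fun b : pos_root =>
    let u := val b in
    let al := simple_root s in
    let c := form al u in
    if u == al then 0
    else if c == 0 then e_ u
    else if 0 < c then y_Qxy *: e_ (u - c *: al)
    else (1 - y_Qxy) *: e_ u + e_ (u + (- c) *: al)).

Definition psi_gen (s : S) : V -> V :=
  fglift (fun b : pos_root =>
    phi s (e_ (val b))
    + (x_Qxy * Qy_to_Qxy (T_poly s (val b))) *: e_ (simple_root s)).

End Coxeter.

Arguments sigma {S} M s.
Arguments phi {S} M {R} s.
Arguments psi_gen {S} M {R} s.

(* Main.v *)
(* Faithfulness. Specialise x = 0 and y = 1/2. Then psi_s becomes phi_s, whose
   matrix is nonnegative, so supports of products are products of supports. The
   row of e_(alpha_s) in the matrix of psi(g) specialises to 0 iff sigma_s
   divides g on the left. It does vanish then, as e_(alpha_s) does not occur in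
   the image of phi_s. Conversely let g = sigma_t g' not be divisible by sigma_s.
   If m_st = 2, or if sigma_s does not divide g', the row for g' is nonzero by
   induction and the coefficient of phi_t at (alpha_s, alpha_s) is positive;
   otherwise g = sigma_t sigma_s g'' with g'' not divisible by sigma_t, and one
   uses that phi_s, then phi_t lead from alpha_t through alpha_s + alpha_t to
   alpha_s. Thus psi(g) tells which generators divide g, and since each psi_s is
   invertible, g is recovered by induction on its length.

   Existence of psi. With phi the representation at x = 0, the braid relations
   amount to T_s phi_t = T_s when m_st = 2 and T_t phi_s = T_s phi_t when
   m_st = 3. Putting T(s, u) = kap(s, u) + y^dp(u) (y - 1) makes the recursion
   homogeneous, with kap(s, u) = 0 when <alpha_s, u> > 0 and u <> alpha_s. That
   it holds for every t with <alpha_t, u> > 0, not only for the chosen one, is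
   shown by induction on the depth; two choices t, q involve only the parabolic
   subgroup of s, t, q, which has type A1 x A1 x A1, A1 x A2 or A3 because there
   is no triangle. Finally (psi_s - 1)(psi_s + y) maps every basis vector to a
   multiple of e_(alpha_s), an eigenvector of psi_s with eigenvalue x y^2; this
   yields a cubic equation for psi_s, with nonzero constant term. *)
From HB Require Import structures.
From mathcomp Require Import all_boot all_order all_algebra.
From mathcomp Require Import boolp reals.
From mathcomp Require Import freeg.
From mathcomp Require Import zify ring lra.
Require Import Defs.

Set Implicit Arguments.
Unset Strict Implicit.
Unset Printing Implicit Defensive.

Import Order.TTheory GRing.Theory Num.Theory.

Local Open Scope ring_scope.

(** * Positive roots and depth *)

Section Roots.
Variables (R : realType) (S : finType) (M : coxeterMatrix S).
Hypothesis hsmall : small_type M.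

Local Notation al := (simple_root R).
Local Notation c s u := (form M (simple_root R s) u).
Local Notation r := (@reflection S M R).
Local Notation U := (rootspace S R).

Lemma small_neq2 (s t : S) : s != t -> M s t != 2%N -> M s t = 3%N.
Proof. by move=> st; case: (hsmall st) => ->. Qed.

Lemma form_refl_self (s : S) (u : U) : c s (r s u) = - c s u.
Proof. rewrite form_subZ basis_form1; ring. Qed.

Lemma form_refl2 (s t : S) (u : U) : M s t = 2%N -> c s (r t u) = c s u.
Proof. by move=> m; rewrite form_subZ basis_form2 // mulr0 subr0. Qed.

Lemma form_refl3 (s t : S) (u : U) : M s t = 3%N -> c s (r t u) = c s u + c t u.
Proof. by move=> m; rewrite form_subZ basis_form3 // mulrN1 opprK. Qed.

Lemma form_refl33 (s t : S) (u : U) : M s t = 3%N -> c s (r t (r s u)) = c t u.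
Proof.
move=> m; have m' : M t s = 3%N by rewrite cox_sym.
by rewrite form_refl3 // form_refl_self form_refl3 // addrC addrK.
Qed.

Lemma refl_id (s : S) (u : U) : c s u = 0 -> r s u = u.
Proof. by rewrite /reflection => ->; rewrite scale0r subr0. Qed.

Lemma refl_comm (s t : S) (u : U) : M s t = 2%N -> r s (r t u) = r t (r s u).
Proof.
move=> m; have m' : M t s = 2%N by rewrite cox_sym.
rewrite {1}/reflection form_refl2 // [in RHS]/reflection form_refl2 //.
by rewrite /reflection addrAC.
Qed.

Lemma refl_braid (s t : S) (u : U) : M s t = 3%N ->
  r s (r t (r s u)) = r t (r s (r t u)).
Proof.
move=> m; have m' : M t s = 3%N by rewrite cox_sym.
have E p q : M p q = 3%N -> M q p = 3%N -> r p (r q (r p u)) =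
    u - (c p u + c q u) *: al p - (c p u + c q u) *: al q.
  move=> pq qp.
  rewrite {1}/reflection form_refl3 // form_refl_self form_refl3 //.
  rewrite {1}/reflection form_refl3 // /reflection.
  by apply/ffunP => x; rewrite !ffunE /GRing.scale /=; ring.
by rewrite !E // addrAC (addrC (c s u)).
Qed.

Lemma reflN (s : S) (u : U) : r s (- u) = - r s u.
Proof.
rewrite /reflection; have -> : c s (- u) = - c s u.
  rewrite !form_simple_rootl -sumrN.
  by apply: eq_bigr => q _; rewrite !ffunE mulNr.
by rewrite scaleNr opprB opprK addrC.
Qed.

Lemma refl_simple_self (s : S) : r s (al s) = - al s.
Proof.
rewrite /reflection form_simple_root basis_form1.
by apply/ffunP => q; rewrite !ffunE /GRing.scale /=; ring.
Qed.

Lemma form_simple_le0 (s t : S) : s != t -> c s (al t) <= 0.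
Proof.
rewrite form_simple_root => /hsmall[] m; first by rewrite basis_form2.
by rewrite basis_form3 //; lra.
Qed.

Lemma form_simple_self (s : S) : c s (al s) = 2.
Proof. by rewrite form_simple_root basis_form1. Qed.

Lemma form_simple3 (s t : S) : M s t = 3%N -> c s (al t) = -1.
Proof. by move=> m; rewrite form_simple_root basis_form3. Qed.

Lemma form_simple2 (s t : S) : M s t = 2%N -> c s (al t) = 0.
Proof. by move=> m; rewrite form_simple_root basis_form2. Qed.

Lemma simple_root_inj : injective (@simple_root S R).
Proof.
move=> s t /ffunP /(_ s); rewrite !ffunE eqxx.
by case: eqP => // _ /eqP; rewrite oner_eq0.
Qed.

Lemma M_neq (s t : S) : M s t != 1%N -> s != t.
Proof. by apply: contra => /eqP ->; rewrite cox_diag. Qed.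

Lemma refl_refl_simple3 (s t : S) : M s t = 3%N -> r s (r t (al s)) = al t.
Proof.
move=> m; have m' : M t s = 3%N by rewrite cox_sym.
rewrite {1}/reflection form_refl3 // form_simple_self.
rewrite /reflection !form_simple3 //.
by apply/ffunP => q; rewrite !ffunE /GRing.scale /=; ring.
Qed.

(* [ranked n u] turns out to mean that u is a positive root of depth n; it
   replaces the word length of W in all the inductions on the depth. *)
Inductive ranked : nat -> U -> Prop :=
| ranked1 s : ranked 1 (al s)
| rankedS n s u of ranked n u & c s u < 0 : ranked n.+1 (r s u).

(** Each reflection in [rankedS] adds the positive multiple [- c s u] of [al s], so no coefficient
    ever decreases. *)
Lemma ranked_ge0 n u : ranked n u -> forall s, 0 <= u s.
Proof.
elim=> [s t|{}n s {}u _ IH cu t]; first by rewrite ffunE; case: eqP.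
have u0 := IH t; rewrite !ffunE /GRing.scale /=.
by case: eqP => _; rewrite ?mulr0 ?mulr1 ?subr0 //; lra.
Qed.

Lemma ranked_gt0 n u : ranked n u -> exists s, 0 < u s.
Proof.
elim=> [s|{}n s {}u _ [t ut] cu]; first by exists s; rewrite ffunE eqxx.
exists t; rewrite !ffunE /GRing.scale /=.
by case: eqP => _; rewrite ?mulr0 ?mulr1 ?subr0 //; lra.
Qed.

Lemma rankedN n u : ranked n u -> ~ forall s, 0 <= (- u) s.
Proof. by move=> /ranked_gt0[s us] /(_ s); rewrite ffunE; lra. Qed.

Lemma ranked_up n s u : ranked n u -> c s u < 0 -> ranked n.+1 (r s u).
Proof. exact: rankedS. Qed.

(** If [al s] arose by a step [t], its predecessor would be [r t (al s)]. For [t = s] this is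
    negative, and for [t] other than [s] its pairing with [al t] is nonnegative, so that [rankedS]
    does not apply. *)
Lemma ranked_simple n s : ranked n (al s) -> n = 1%N.
Proof.
move E: (al s) => u Pu; case: Pu E => // {n u} n t u Pu cu E.
have uE : u = r t (al s) by rewrite E reflectionK.
have [ts|/form_simple_le0] := eqVneq t s.
  case: (rankedN Pu) => x.
  by rewrite uE ts refl_simple_self opprK ffunE; case: eqP.
by move=> H; exfalso; move: H cu; rewrite uE form_refl_self; lra.
Qed.

(** The definition of [ranked] records a single descent; here every [s] with positive pairing
    becomes one. Strong induction compares [s] with the last reflection [t] inside the dihedral
    group generated by the two. *)
Lemma ranked_down n s u : ranked n u -> 0 < c s u -> u <> al s ->
  exists2 k, n = k.+1 & ranked k (r s u).
Proof.
move: n u s; elim/ltn_ind => n IH u s Pu; case: Pu IH.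
  move=> t _ ct ns; exfalso; have /form_simple_le0 : s != t.
    by apply/eqP => st; apply: ns; rewrite st.
  by rewrite leNgt ct.
move=> {u n} n t u Pu cu IH csu _.
exists n => //.
have [st|st] := eqVneq s t; first by rewrite st reflectionK.
have [m|/(small_neq2 st) m] := eqVneq (M s t) 2%N.
  rewrite form_refl2 // in csu; rewrite refl_comm //.
  have [|k nk Pk] := IH n (ltnSn n) _ s Pu csu.
    by move=> uE; move: cu; rewrite uE form_simple2 ?ltxx // cox_sym.
  by rewrite nk; apply: ranked_up => //; rewrite form_refl2 // cox_sym.
have m' : M t s = 3%N by rewrite cox_sym.
rewrite form_refl3 // in csu.
have [uE|/eqP us] := eqVneq u (al s).
  rewrite uE in Pu *; rewrite refl_refl_simple3 // (ranked_simple Pu).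
  exact: ranked1.
(* Now [c s u > 0 > c t u]. From [u] the path goes down by [s] and by [t], then up by [s]; the braid
   relation identifies the root reached with [r t (r s (r t u))], and one more step up by [t] gives
   [r s (r t u)]. *)
have [|k nk Pk] := IH n (ltnSn n) _ s Pu _ us; first by lra.
have cts : c t (r s u) = c t u + c s u by rewrite form_refl3.
have kn : (k < n.+1)%N by rewrite nk; lia.
have ct_gt0 : 0 < c t (r s u) by rewrite cts; lra.
have [sE|l kl Pl] := IH k kn _ t Pk ct_gt0.
  have : c t (r s (r s u)) = 1.
    by rewrite sE form_refl3 // form_simple_self form_simple3 //; lra.
  by rewrite reflectionK; lra.
have : ranked k (r s (r t (r s u))).
  rewrite kl; apply: ranked_up => //.
  by rewrite form_refl3 // form_refl_self cts; lra.
rewrite refl_braid // => Q.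
rewrite nk -(reflectionK M t (r s (r t u))); apply: ranked_up => //.
by rewrite form_refl_self form_refl3 // form_refl_self form_refl3 //; lra.
Qed.

Lemma ranked_refl0 n s u : ranked n u -> c s u = 0 -> ranked n (r s u).
Proof. by move=> Pu /refl_id ->. Qed.

(** Prepares the lower bound for the depth: one letter of a word lowers the rank by at most one. The
    root [al s] is set apart because [s] makes it negative. *)
Lemma ranked_refl n s u : ranked n u -> u <> al s ->
  exists2 k, ranked k (r s u) & (n <= k.+1)%N.
Proof.
move=> Pu us; have [cu|cu|cu] := ltgtP (c s u) 0.
- by exists n.+1; [exact: ranked_up | lia].
- by have [k nk Pk] := ranked_down Pu cu us; exists k; rewrite ?nk.
- by exists n => //; apply: ranked_refl0.
Qed.

(** Retracing the construction of [u] ends at a simple root, which one more letter makes negative.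
    This is the upper bound for the depth. *)
Lemma ranked_word n u : ranked n u ->
  exists2 v, size v = n & exists s, foldr r u v = - al s.
Proof.
elim=> [s|{}n s {}u Pu [v <- [t E]] cu].
  by exists [:: s] => //; exists s; rewrite /= refl_simple_self.
exists (rcons v s); first by rewrite size_rcons.
by exists t; rewrite -cats1 foldr_cat /= reflectionK.
Qed.

Definition root_ranked (u : U) := exists n, ranked n u \/ ranked n (- u).

(** The only positive root that [s] makes negative is [al s], and its image is [- al s]; so the
    dichotomy of positive and negative roots is stable under simple reflections. *)
Lemma root_ranked_refl s u : root_ranked u -> root_ranked (r s u).
Proof.
have H n v : ranked n v -> root_ranked (r s v).
  have [->|/eqP vs] := eqVneq v (al s).
    by exists 1%N; right; rewrite refl_simple_self opprK; exact: ranked1.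
  by move=> /ranked_refl -/(_ s vs)[k Pk _]; exists k; left.
case=> n [/H //|/H[k]]; rewrite reflN opprK => -[] Pk; exists k; by [right|left].
Qed.

Lemma root_ranked_foldr v u : root_ranked u -> root_ranked (foldr r u v).
Proof. by move=> Pu; elim: v => //= s v; exact: root_ranked_refl. Qed.

Lemma root_rankedP u : is_root M u -> root_ranked u.
Proof.
move=> [w [s ->]]; apply: root_ranked_foldr; exists 1%N; left; exact: ranked1.
Qed.

Lemma cox_act_reflection (v : seq S) (u : U) :
  cox_act (word (coxeter_rel M) v) u = foldr r u v.
Proof. exact: cox_act_word. Qed.

Lemma pos_rootP u : is_pos_root M u <-> exists n, ranked n u.
Proof.
split=> [[/root_rankedP[n [Pu|Pu]] u0]|[n Pu]]; first by exists n.
  by case: (rankedN Pu); rewrite opprK.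
split; last exact: ranked_ge0 Pu.
have [v _ [s E]] := ranked_word Pu.
(* Simple reflections are involutions, so [rev v] undoes [v]; the letter [s] first turns [al s] into
   [- al s]. *)
exists (word (coxeter_rel M) (rev v ++ [:: s])), s.
rewrite cox_act_reflection foldr_cat /= refl_simple_self -E {E}.
elim/last_ind: v u {Pu} => [|v t IH] u //=.
by rewrite rev_rcons /= -cats1 foldr_cat /= -IH reflectionK.
Qed.

End Roots.

Lemma leastP (P : nat -> Prop) : (exists n, P n) ->
  P (least P) /\ forall n, P n -> (least P <= n)%N.
Proof.
move=> [n Pn]; rewrite /least; case: pselect => [ex|[]]; last first.
  by exists n; apply/asboolP.
by case: ex_minnP => m /asboolP Pm mP; split=> // k Pk; apply: mP; apply/asboolP.
Qed.

(** * The depth of a positive root is its rank *)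

Section Depth.
Variables (R : realType) (S : finType) (M : coxeterMatrix S).
Hypothesis hsmall : small_type M.

Local Notation al := (simple_root R).
Local Notation c s u := (form M (simple_root R s) u).
Local Notation r := (@reflection S M R).
Local Notation U := (rootspace S R).
Local Notation ranked := (@ranked R S M).

Lemma cox_length_le v : (cox_length (word (coxeter_rel M) v) <= size v)%N.
Proof.
apply: (proj2 (@leastP (fun n => exists2 u, size u = n &
  word (coxeter_rel M) u = word (coxeter_rel M) v) _)); last by exists v.
by exists (size v), v.
Qed.

Lemma cox_lengthP (w : coxeter_group M) :
  exists2 v, size v = cox_length w & word (coxeter_rel M) v = w.
Proof.
apply: (proj1 (@leastP (fun n => exists2 u, size u = n &
  word (coxeter_rel M) u = w) _)).
by exists (size (repr w)), (repr w) => //; exact: word_repr.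
Qed.

(** [foldr] applies the last letter first, hence the induction from the right. Each letter lowers
    the rank by at most one, and only a simple root, of rank one, can turn negative. *)
Lemma ranked_word_min n (u : U) v : ranked n u -> is_neg_root M (foldr r u v) ->
  (n <= size v)%N.
Proof.
elim/last_ind: v n u => [|v s IH] n u Pu.
  by move=> /(pos_rootP hsmall)[k /ranked_ge0/=H]; case: (rankedN Pu).
rewrite -cats1 foldr_cat /= cats1 size_rcons => neg.
have [us|/eqP us] := eqVneq u (al s).
  by move: Pu; rewrite us => /(ranked_simple hsmall) ->.
have [k Pk nk] := ranked_refl hsmall Pu us.
by have := IH _ _ Pk neg; lia.
Qed.

(** The word from [ranked_word] bounds the depth from above and shows that the minimum exists, so
    that [least] does not take its default value. [ranked_word_min], applied to a shortest word of a
    minimal [w], bounds it from below. *)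
Lemma depth_ranked n u : ranked n u -> depth M u = n.
Proof.
move=> Pu; have [v sv [s E]] := ranked_word Pu.
have neg : is_neg_root M (cox_act (word (coxeter_rel M) v) u).
  rewrite cox_act_reflection // E /is_neg_root opprK.
  by apply/(pos_rootP hsmall); exists 1%N; exact: ranked1.
have ex : exists n, exists2 w : coxeter_group M, cox_length w = n &
    is_neg_root M (cox_act w u).
  by exists (cox_length (word (coxeter_rel M) v)), (word (coxeter_rel M) v).
have [[w wE wneg] wmin] := leastP ex.
apply/eqP; rewrite eqn_leq; apply/andP; split.
  rewrite -sv; apply: leq_trans (cox_length_le v).
  by apply: wmin; exists (word (coxeter_rel M) v).
rewrite -[depth M u]wE; have [v' <- v'E] := cox_lengthP w.
apply: ranked_word_min Pu _.
by rewrite -cox_act_reflection // v'E.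
Qed.

End Depth.

(** * Independence of the choices in the recursion, by rank-three parabolics *)

Section Independence.
Variables (R : realDomainType) (S : finType) (M : coxeterMatrix S) (U : Type).
Variables (al : S -> U) (c : S -> U -> R) (r : S -> U -> U).
Hypothesis rK : forall s, involutive (r s).
Hypothesis c_simple_self : forall s, c s (al s) = 2.
Hypothesis c_simple2 : forall s t, M s t = 2%N -> c s (al t) = 0.
Hypothesis c_simple3 : forall s t, M s t = 3%N -> c s (al t) = -1.
Hypothesis c_refl_self : forall s u, c s (r s u) = - c s u.
Hypothesis c_refl2 : forall s t u, M s t = 2%N -> c s (r t u) = c s u.
Hypothesis c_refl3 : forall s t u, M s t = 3%N -> c s (r t u) = c s u + c t u.
Hypothesis refl_refl_simple3 :
  forall s t, M s t = 3%N -> r s (r t (al s)) = al t.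
Hypothesis refl_comm :
  forall s t u, M s t = 2%N -> r s (r t u) = r t (r s u).
Hypothesis refl_braid :
  forall s t u, M s t = 3%N -> r s (r t (r s u)) = r t (r s (r t u)).

Lemma c_refl33 s t u : M s t = 3%N -> c s (r t (r s u)) = c t u.
Proof.
move=> m; have m' : M t s = 3%N by rewrite cox_sym.
by rewrite c_refl3 // c_refl_self c_refl3 // addrC addrK.
Qed.

Variable K : S -> U -> {poly rat}.

(** The right-hand side of the recursion for [kap] through the descent [t]. When [M s t = 3],
    [c s v] is b - a in the notation of the definition of T, and the case of pairing zero with
    [al s] is merged with b > a. *)
Definition descent s t u : {poly rat} :=
  let v := r t u in
  if M s t == 2%N then 'X * K s v
  else if 0 < c s v then 'X * K t (r s v)
  else if c s v == 0 then K t v + ('X - 1) * K s v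
  else 'X * K s v + K t v.

(** The condition under which [r t u] is again a positive root, of smaller depth. *)
Definition falls t u := 0 < c t u /\ u <> al t.

Lemma descent2 s t u : M s t = 2%N -> descent s t u = 'X * K s (r t u).
Proof. by rewrite /descent => ->. Qed.

Lemma descent3_gt0 s t u : M s t = 3%N -> 0 < c s u + c t u ->
  descent s t u = 'X * K t (r s (r t u)).
Proof. by move=> m cu; rewrite /descent m /= c_refl3 // cu. Qed.

Lemma descent3_eq0 s t u : M s t = 3%N -> c s u + c t u = 0 ->
  descent s t u = K t (r t u) + ('X - 1) * K s (r t u).
Proof. by move=> m cu; rewrite /descent m /= c_refl3 // cu ltxx eqxx. Qed.

Lemma descent3_lt0 s t u : M s t = 3%N -> c s u + c t u < 0 ->
  descent s t u = 'X * K s (r t u) + K t (r t u).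
Proof.
by move=> m cu; rewrite /descent m /= c_refl3 // ltNge ltW //= lt_eqF.
Qed.

(* B u will be: u is a positive root of depth smaller than that under study. *)
Variable B : U -> Prop.
Hypothesis B_down : forall s u, B u -> falls s u -> B (r s u).
Hypothesis Kdown : forall s t u, B u -> falls t u -> c s u <= 0 ->
  K s u = descent s t u.
Hypothesis Ksimple : forall s t, s != t -> K s (al t) = 'X * (1 - 'X).

Lemma K2 s t v : B v -> M s t = 2%N -> falls t v -> c s v <= 0 ->
  K s v = 'X * K s (r t v).
Proof. by move=> Pv m ft cs; rewrite (Kdown Pv ft cs) descent2. Qed.

Lemma K3_gt0 s t v : B v -> M s t = 3%N -> falls t v -> c s v <= 0 ->
  0 < c s v + c t v -> K s v = 'X * K t (r s (r t v)).
Proof. by move=> Pv m ft cs ?; rewrite (Kdown Pv ft cs) descent3_gt0. Qed.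

Lemma K3_eq0 s t v : B v -> M s t = 3%N -> falls t v -> c s v <= 0 ->
  c s v + c t v = 0 -> K s v = K t (r t v) + ('X - 1) * K s (r t v).
Proof. by move=> Pv m ft cs ?; rewrite (Kdown Pv ft cs) descent3_eq0. Qed.

Lemma K3_lt0 s t v : B v -> M s t = 3%N -> falls t v -> c s v <= 0 ->
  c s v + c t v < 0 -> K s v = 'X * K s (r t v) + K t (r t v).
Proof. by move=> Pv m ft cs ?; rewrite (Kdown Pv ft cs) descent3_lt0. Qed.

(** * Comparison of two descents [t] and [q] at [u] *)

Section Triple.
Variables (s t q : S) (u : U).
Hypotheses (Pt : B (r t u)) (Pq : B (r q u)) (ct : 0 < c t u) (cq : 0 < c q u).
Hypothesis cs : c s u <= 0.

(* lra inspects every local hypothesis but no section hypothesis. *)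
Ltac clear_lra :=
  repeat match goal with
  | H : B (r _ (r _ _)) |- _ => clear H
  | H : falls _ _ |- _ => clear H
  | H : _ <> _ |- _ => clear H
  end; lra.
Ltac lin E := move: ct cq cs; rewrite ?E; clear_lra.
(** A root equal to a simple root has known pairings 2, 0 or -1 with [s], [t] and [q]. Rewritten by
    the table [E] in terms of the pairings of [u], these equations contradict the sign assumptions
    linearly. *)
Ltac nonsimple E :=
  let H := fresh in
  intro H; move: ct cq cs (congr1 (c s) H) (congr1 (c t) H)
    (congr1 (c q) H); rewrite ?E; clear H; clear_lra.
Ltac fall E :=
  first [assumption | by split; [lin E | assumption]
    | by split; [lin E | nonsimple E]].
Ltac down E P :=
  lazymatch goal with |- ?F /\ _ =>
    let H := fresh in
    assert (H : F) by fall E; split; [exact: H | exact: (B_down P H)]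
  end.
Ltac step2 E L := rewrite (L ltac:(fall E) ltac:(lin E)).
Ltac step3 E L := rewrite (L ltac:(fall E) ltac:(lin E) ltac:(lin E)).

Section A1A1A1.
Hypotheses (st : M s t = 2%N) (sq : M s q = 2%N) (tq : M t q = 2%N).

Let ts : M t s = 2%N. Proof. by rewrite cox_sym. Qed.
Let qs : M q s = 2%N. Proof. by rewrite cox_sym. Qed.
Let qt : M q t = 2%N. Proof. by rewrite cox_sym. Qed.

Let E := (fun v => @c_refl2 _ _ v st, fun v => @c_refl2 _ _ v sq,
  fun v => @c_refl2 _ _ v tq, fun v => @c_refl2 _ _ v ts,
  fun v => @c_refl2 _ _ v qs,
  fun v => @c_refl2 _ _ v qt, c_refl_self, c_simple_self,
  @c_simple2 _ _ st, @c_simple2 _ _ sq, @c_simple2 _ _ tq, @c_simple2 _ _ ts,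
  @c_simple2 _ _ qs, @c_simple2 _ _ qt).

Lemma indep_A1A1A1 : descent s t u = descent s q u.
Proof.
rewrite !descent2 //; step2 E (K2 Pt sq); step2 E (K2 Pq st).
by rewrite (refl_comm _ tq).
Qed.

End A1A1A1.

(** * [t] commutes with [s] and [q], which are joined *)

Section A1A2.
Hypotheses (st : M s t = 2%N) (sq : M s q = 3%N) (tq : M t q = 2%N).

Let ts : M t s = 2%N. Proof. by rewrite cox_sym. Qed.
Let qs : M q s = 3%N. Proof. by rewrite cox_sym. Qed.
Let qt : M q t = 2%N. Proof. by rewrite cox_sym. Qed.

Let E := (fun v => @c_refl2 _ _ v st, fun v => @c_refl3 _ _ v sq,
  fun v => @c_refl2 _ _ v tq, fun v => @c_refl2 _ _ v ts,
  fun v => @c_refl3 _ _ v qs,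
  fun v => @c_refl2 _ _ v qt, c_refl_self, c_simple_self,
  @c_simple2 _ _ st, @c_simple3 _ _ sq, @c_simple2 _ _ tq, @c_simple2 _ _ ts,
  @c_simple3 _ _ qs, @c_simple2 _ _ qt).

(** Applying [r t] changes neither [c s u] nor [c q u], so the same case of the descent through [q]
    occurs at [u] and at [r t u]. *)
Lemma indep_A1A2 : descent s t u = descent s q u.
Proof.
rewrite descent2 //.
have [h|h|h] := ltgtP (c s u + c q u) 0.
- rewrite descent3_lt0 //; step3 E (K3_lt0 Pt sq).
  step2 E (K2 Pq st); step2 E (K2 Pq qt).
  by rewrite (refl_comm _ tq); ring.
- rewrite descent3_gt0 //; step3 E (K3_gt0 Pt sq).
  have [FPsq Psq] : falls s (r q u) /\ B (r s (r q u)) by down E Pq.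
  step2 E (K2 Psq qt).
  by rewrite -(refl_comm _ st) (refl_comm _ tq).
- rewrite descent3_eq0 //; step3 E (K3_eq0 Pt sq).
  step2 E (K2 Pq st); step2 E (K2 Pq qt).
  by rewrite (refl_comm _ tq); ring.
Qed.

End A1A2.

(** * [s] commutes with [t] and [q], which are joined *)

Section A2A1.
Hypotheses (st : M s t = 2%N) (sq : M s q = 2%N) (tq : M t q = 3%N).
Hypotheses (snt : s != t) (snq : s != q).

Let ts : M t s = 2%N. Proof. by rewrite cox_sym. Qed.
Let qs : M q s = 2%N. Proof. by rewrite cox_sym. Qed.
Let qt : M q t = 3%N. Proof. by rewrite cox_sym. Qed.

Let E := (fun v => @c_refl2 _ _ v st, fun v => @c_refl2 _ _ v sq,
  fun v => @c_refl3 _ _ v tq, fun v => @c_refl2 _ _ v ts,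
  fun v => @c_refl2 _ _ v qs,
  fun v => @c_refl3 _ _ v qt, c_refl_self, c_simple_self,
  @c_simple2 _ _ st, @c_simple2 _ _ sq, @c_simple3 _ _ tq, @c_simple2 _ _ ts,
  @c_simple2 _ _ qs, @c_simple3 _ _ qt).

Lemma indep_A2A1 : descent s t u = descent s q u.
Proof.
rewrite !descent2 //.
(* This is the root [al t + al q]: the two descents end at the simple roots [al q] and [al t], from
   which no further descent is possible, and the explicit values [Ksimple] agree. *)
have [e|ne] := pselect (r t u = al q).
  have -> : r q u = al t.
    by rewrite -(rK t u) e refl_refl_simple3.
  by rewrite e !Ksimple.
have ne' : r q u <> al t.
  by move=> e; apply: ne; rewrite -(rK q u) e refl_refl_simple3.
have [FPqt Pqt] : falls q (r t u) /\ B (r q (r t u)).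
  by down E Pt.
have [FPtq Ptq] : falls t (r q u) /\ B (r t (r q u)).
  by down E Pq.
rewrite (K2 Pt sq ltac:(fall E) ltac:(lin E)).
rewrite (K2 Pq st ltac:(fall E) ltac:(lin E)).
step2 E (K2 Pqt st); step2 E (K2 Ptq sq).
by rewrite (refl_braid _ tq).
Qed.

End A2A1.

(** * Type A3 with [s] as the middle node *)

Section A3center.
Hypotheses (st : M s t = 3%N) (sq : M s q = 3%N) (tq : M t q = 2%N).

Let ts : M t s = 3%N. Proof. by rewrite cox_sym. Qed.
Let qs : M q s = 3%N. Proof. by rewrite cox_sym. Qed.
Let qt : M q t = 2%N. Proof. by rewrite cox_sym. Qed.

Let E := (fun v => @c_refl33 _ _ v st, fun v => @c_refl33 _ _ v ts,
  fun v => @c_refl33 _ _ v sq, fun v => @c_refl33 _ _ v qs,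
  fun v => @c_refl3 _ _ v st, fun v => @c_refl3 _ _ v sq,
  fun v => @c_refl2 _ _ v tq, fun v => @c_refl3 _ _ v ts,
  fun v => @c_refl3 _ _ v qs,
  fun v => @c_refl2 _ _ v qt, c_refl_self, c_simple_self,
  @c_simple3 _ _ st, @c_simple3 _ _ sq, @c_simple2 _ _ tq, @c_simple3 _ _ ts,
  @c_simple3 _ _ qs, @c_simple2 _ _ qt).

Let tqE v : r q (r t v) = r t (r q v). Proof. by rewrite (refl_comm _ qt). Qed.

Lemma indep_A3center_eq_gt : c s u + c q u = 0 -> 0 < c s u + c t u ->
  descent s t u = descent s q u.
Proof.
move=> h1 h2.
have [FPtq Ptq] : falls t (r q u) /\ B (r t (r q u)) by down E Pq.
have [FPst Pst] : falls s (r t u) /\ B (r s (r t u)) by down E Pt.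
have [FPqst Pqst] : falls q (r s (r t u)) /\ B (r q (r s (r t u)))
  by down E Pst.
have [FPstq Pstq] : falls s (r t (r q u)) /\ B (r s (r t (r q u)))
  by down E Ptq.
rewrite descent3_gt0 // descent3_eq0 //.
step2 E (K2 Pst tq); step3 E (K3_eq0 Pqst ts).
step2 E (K2 Pq qt); step3 E (K3_gt0 Ptq qs).
step3 E (K3_gt0 Pq st); step2 E (K2 Pstq tq).
rewrite (refl_braid _ sq) tqE; ring.
Qed.

Lemma indep_A3center_eq_eq : c s u + c q u = 0 -> c s u + c t u = 0 ->
  descent s t u = descent s q u.
Proof.
move=> h1 h2.
have [FPtq Ptq] : falls t (r q u) /\ B (r t (r q u)) by down E Pq.
have [FPstq Pstq] : falls s (r t (r q u)) /\ B (r s (r t (r q u)))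
  by down E Ptq.
rewrite !descent3_eq0 //; step2 E (K2 Pt tq); step2 E (K2 Pq qt).
step3 E (K3_gt0 Pt sq); step3 E (K3_gt0 Pq st).
rewrite tqE; step3 E (K3_eq0 Ptq ts); step3 E (K3_eq0 Ptq qs); ring.
Qed.

Lemma indep_A3center_gt_gt (tnq : t != q) : 0 < c s u + c q u ->
  0 < c s u + c t u -> descent s t u = descent s q u.
Proof.
move=> h1 h2.
have [FPst Pst] : falls s (r t u) /\ B (r s (r t u)) by down E Pt.
have [FPsq Psq] : falls s (r q u) /\ B (r s (r q u)) by down E Pq.
rewrite !descent3_gt0 //.
(* The exceptional root is [al s + al t + al q], the highest root of A3: one path ends at [al q],
   the other at [al t], and again the values [Ksimple] are compared. *)
have key v w : r s (r t v) = al w -> M t w = 2%N -> M s w = 3%N ->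
    r s (r w v) = al t.
  move=> e tw sw; have ws : M w s = 3%N by rewrite cox_sym.
  have wt : M w t = 2%N by rewrite cox_sym.
  have -> : v = r t (r s (al w)) by rewrite -e !rK.
  by rewrite (refl_comm _ wt) (refl_refl_simple3 ws) (refl_refl_simple3 st).
have [e|ne] := pselect (r s (r t u) = al q).
  by rewrite (key _ _ e tq sq) e !Ksimple // eq_sym.
have ne' : r s (r q u) <> al t.
  move=> e; apply: ne.
  have -> : u = r q (r s (al t)) by rewrite -e !rK.
  by rewrite (refl_comm _ tq) (refl_refl_simple3 ts) (refl_refl_simple3 sq).
have [FPqst Pqst] : falls q (r s (r t u)) /\ B (r q (r s (r t u)))
  by down E Pst.
have [FPtsq Ptsq] : falls t (r s (r q u)) /\ B (r t (r s (r q u)))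
  by down E Psq.
rewrite (K2 Pst tq ltac:(fall E) ltac:(lin E)).
rewrite (K2 Psq qt ltac:(fall E) ltac:(lin E)).
step3 E (K3_gt0 Pqst ts); step3 E (K3_gt0 Ptsq qs).
by rewrite (refl_braid _ sq) (refl_braid _ st) !tqE.
Qed.

Lemma indep_A3center_lt_eq : c s u + c q u < 0 -> c s u + c t u = 0 ->
  descent s t u = descent s q u.
Proof.
move=> h1 h2.
have [FPtq Ptq] : falls t (r q u) /\ B (r t (r q u)) by down E Pq.
have [FPstq Pstq] : falls s (r t (r q u)) /\ B (r s (r t (r q u)))
  by down E Ptq.
rewrite descent3_eq0 // descent3_lt0 //.
step2 E (K2 Pt tq); step2 E (K2 Pq qt).
step3 E (K3_gt0 Pt sq); step3 E (K3_gt0 Pq st).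
rewrite tqE; step3 E (K3_lt0 Ptq ts); step3 E (K3_eq0 Ptq qs); ring.
Qed.

Lemma indep_A3center_lt_gt : c s u + c q u < 0 -> 0 < c s u + c t u ->
  descent s t u = descent s q u.
Proof.
move=> h1 h2.
have [FPtq Ptq] : falls t (r q u) /\ B (r t (r q u)) by down E Pq.
have [FPst Pst] : falls s (r t u) /\ B (r s (r t u)) by down E Pt.
have [FPqst Pqst] : falls q (r s (r t u)) /\ B (r q (r s (r t u)))
  by down E Pst.
have [FPstq Pstq] : falls s (r t (r q u)) /\ B (r s (r t (r q u)))
  by down E Ptq.
rewrite descent3_gt0 // descent3_lt0 //.
step2 E (K2 Pst tq); step3 E (K3_lt0 Pqst ts).
step3 E (K3_gt0 Pq st); step2 E (K2 Pstq tq).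
step2 E (K2 Pq qt); step3 E (K3_gt0 Ptq qs).
rewrite (refl_braid _ sq) tqE; ring.
Qed.

Lemma indep_A3center_lt_lt : c s u + c q u < 0 -> c s u + c t u < 0 ->
  descent s t u = descent s q u.
Proof.
move=> h1 h2.
have [FPtq Ptq] : falls t (r q u) /\ B (r t (r q u)) by down E Pq.
rewrite !descent3_lt0 //; step2 E (K2 Pt tq); step2 E (K2 Pq qt).
have [h3|h3|h3] := ltgtP (c s u + c t u + c q u) 0.
- step3 E (K3_lt0 Pt sq); step3 E (K3_lt0 Pq st); rewrite tqE; ring.
- step3 E (K3_gt0 Pt sq); step3 E (K3_gt0 Pq st); rewrite tqE.
  step3 E (K3_lt0 Ptq ts); step3 E (K3_lt0 Ptq qs); ring.
- step3 E (K3_eq0 Pt sq); step3 E (K3_eq0 Pq st); rewrite tqE; ring.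
Qed.

(** The assumed order of the pairings with [t] and [q] removes the sign patterns that arise from the
    others by exchanging [t] and [q]. *)
Lemma indep_A3center (tnq : t != q) :
  c q u <= c t u -> descent s t u = descent s q u.
Proof.
move=> cqt; have [h1|h1|h1] := ltgtP (c s u + c q u) 0.
- have [h2|h2|h2] := ltgtP (c s u + c t u) 0.
  + exact: indep_A3center_lt_lt.
  + exact: indep_A3center_lt_gt.
  + exact: indep_A3center_lt_eq.
- by apply: indep_A3center_gt_gt => //; lra.
- have [h2|h2|h2] := ltgtP (c s u + c t u) 0; first by exfalso; lra.
  + exact: indep_A3center_eq_gt.
  + exact: indep_A3center_eq_eq.
Qed.

End A3center.

(** * Type A3 with [s] as an end and [q] as the middle node *)

Section A3end.
Hypotheses (st : M s t = 2%N) (sq : M s q = 3%N) (tq : M t q = 3%N).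

Let ts : M t s = 2%N. Proof. by rewrite cox_sym. Qed.
Let qs : M q s = 3%N. Proof. by rewrite cox_sym. Qed.
Let qt : M q t = 3%N. Proof. by rewrite cox_sym. Qed.

Let E := (fun v => @c_refl33 _ _ v tq, fun v => @c_refl33 _ _ v qt,
  fun v => @c_refl33 _ _ v sq, fun v => @c_refl33 _ _ v qs,
  fun v => @c_refl2 _ _ v st, fun v => @c_refl3 _ _ v sq,
  fun v => @c_refl3 _ _ v tq, fun v => @c_refl2 _ _ v ts,
  fun v => @c_refl3 _ _ v qs, fun v => @c_refl3 _ _ v qt,
  c_refl_self, c_simple_self,
  @c_simple2 _ _ st, @c_simple3 _ _ sq, @c_simple3 _ _ tq, @c_simple2 _ _ ts,
  @c_simple3 _ _ qs, @c_simple3 _ _ qt).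

Let tsE v : r t (r s v) = r s (r t v). Proof. by rewrite (refl_comm _ ts). Qed.

Lemma indep_A3end_eq (snt : s != t) (tnq : t != q) : c s u + c q u = 0 ->
  descent s t u = descent s q u.
Proof.
move=> h1; rewrite descent2 // descent3_eq0 //.
(* Again [al t + al q], but here the two descents follow different formulas: both sides come to y^2
   (1 - y). *)
have [e|ne] := pselect (r q u = al t).
  have -> : r t u = al q.
    by rewrite -(rK q u) e refl_refl_simple3.
  have snq : s != q by apply: (@M_neq _ M); rewrite sq.
  have qnt : q != t by rewrite eq_sym.
  by rewrite e !Ksimple //; ring.
have ne' : r t u <> al q.
  by move=> e; apply: ne; rewrite -(rK t u) e refl_refl_simple3.
have [FPtq Ptq] : falls t (r q u) /\ B (r t (r q u)) by down E Pq.
have [FPqtq Pqtq] : falls q (r t (r q u)) /\ B (r q (r t (r q u)))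
  by down E Ptq.
have [FPqt Pqt] : falls q (r t u) /\ B (r q (r t u)) by down E Pt.
have [FPsqt Psqt] : falls s (r q (r t u)) /\ B (r s (r q (r t u)))
  by down E Pqt.
rewrite (K3_gt0 Pq qt ltac:(fall E) ltac:(lin E) ltac:(lin E)).
rewrite (K2 Pq st ltac:(fall E) ltac:(lin E)).
step3 E (K3_gt0 Ptq sq); step2 E (K2 Pqtq ts).
rewrite (K3_gt0 Pt sq ltac:(fall E) ltac:(lin E) ltac:(lin E)).
step3 E (K3_eq0 Psqt qt).
rewrite tsE (refl_braid _ tq); ring.
Qed.

Lemma indep_A3end_gt : 0 < c s u + c q u -> descent s t u = descent s q u.
Proof.
move=> h1; rewrite descent2 // descent3_gt0 //.
have [FPsq Psq] : falls s (r q u) /\ B (r s (r q u)) by down E Pq.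
have [FPtsq Ptsq] : falls t (r s (r q u)) /\ B (r t (r s (r q u)))
  by down E Psq.
have [FPqtsq Pqtsq] : falls q (r t (r s (r q u))) /\
    B (r q (r t (r s (r q u)))) by down E Ptsq.
have [FPqt Pqt] : falls q (r t u) /\ B (r q (r t u)) by down E Pt.
have [FPsqt Psqt] : falls s (r q (r t u)) /\ B (r s (r q (r t u)))
  by down E Pqt.
step3 E (K3_gt0 Psq qt); step2 E (K2 Pqtsq ts).
step3 E (K3_gt0 Pt sq); step3 E (K3_gt0 Psqt qt).
by rewrite !tsE (refl_braid _ tq) -(refl_braid _ sq).
Qed.

Lemma indep_A3end_lt_lt : c s u + c t u + c q u < 0 ->
  descent s t u = descent s q u.
Proof.
move=> h2; rewrite descent2 // descent3_lt0; [|exact: sq|by lin E].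
have [FPtq Ptq] : falls t (r q u) /\ B (r t (r q u)) by down E Pq.
have [FPqt Pqt] : falls q (r t u) /\ B (r q (r t u)) by down E Pt.
step2 E (K2 Pq st); step3 E (K3_gt0 Pq qt).
step3 E (K3_lt0 Ptq sq); step3 E (K3_lt0 Pt sq); step3 E (K3_lt0 Pqt qt).
step2 E (K2 Pqt st); rewrite (refl_braid _ tq); ring.
Qed.

Lemma indep_A3end_lt_gt : c s u + c q u < 0 -> 0 < c s u + c t u + c q u ->
  descent s t u = descent s q u.
Proof.
move=> h1 h2; rewrite descent2 // descent3_lt0 //.
have [FPtq Ptq] : falls t (r q u) /\ B (r t (r q u)) by down E Pq.
have [FPqt Pqt] : falls q (r t u) /\ B (r q (r t u)) by down E Pt.
have [FPqtq Pqtq] : falls q (r t (r q u)) /\ B (r q (r t (r q u)))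
  by down E Ptq.
have [FPsqt Psqt] : falls s (r q (r t u)) /\ B (r s (r q (r t u)))
  by down E Pqt.
step2 E (K2 Pq st); step3 E (K3_gt0 Pq qt).
step3 E (K3_gt0 Ptq sq); step2 E (K2 Pqtq ts); step3 E (K3_gt0 Pt sq).
step3 E (K3_lt0 Psqt qt).
rewrite tsE (refl_braid _ tq); ring.
Qed.

Lemma indep_A3end_lt_eq : c s u + c t u + c q u = 0 ->
  descent s t u = descent s q u.
Proof.
move=> h2; rewrite descent2 // descent3_lt0; [|exact: sq|by lin E].
have [FPtq Ptq] : falls t (r q u) /\ B (r t (r q u)) by down E Pq.
have [FPqt Pqt] : falls q (r t u) /\ B (r q (r t u)) by down E Pt.
step2 E (K2 Pq st); step3 E (K3_gt0 Pq qt).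
step3 E (K3_eq0 Ptq sq); step3 E (K3_eq0 Pt sq); step3 E (K3_lt0 Pqt qt).
step2 E (K2 Pqt st); rewrite (refl_braid _ tq); ring.
Qed.

Lemma indep_A3end (snt : s != t) (tnq : t != q) : descent s t u = descent s q u.
Proof.
have [h1|h1|h1] := ltgtP (c s u + c q u) 0.
(* This sum is the value of [c s + c q] both at [r t u] and at [r t (r q u)], where the descent
   through [q] is used next. *)
- have [h2|h2|h2] := ltgtP (c s u + c t u + c q u) 0.
  + exact: indep_A3end_lt_lt.
  + exact: indep_A3end_lt_gt.
  + exact: indep_A3end_lt_eq.
- exact: indep_A3end_gt.
- exact: indep_A3end_eq.
Qed.

End A3end.
End Triple.

Lemma edge3 s t : M s t = 3%N -> edge M s t.
Proof. by rewrite /edge => ->. Qed.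

(** Of the eight choices of the three Coxeter entries, one is a triangle. The others are the
    rank-three types treated above, up to exchanging [t] and [q]. *)
Lemma descent_indep (hsmall : small_type M) (htri : no_triangle M) s t q u :
  s != t -> s != q -> t != q -> B (r t u) -> B (r q u) ->
  0 < c t u -> 0 < c q u -> c s u <= 0 -> descent s t u = descent s q u.
Proof.
move=> snt snq tnq Pt Pq ct cq cs.
have qnt : q != t by rewrite eq_sym.
have sym x y k : M x y = k -> M y x = k by rewrite cox_sym.
case: (hsmall _ _ snt) => st; case: (hsmall _ _ snq) => sq;
  case: (hsmall _ _ tnq) => tq.
- exact: indep_A1A1A1.
- exact: indep_A2A1.
- exact: indep_A1A2.
- exact: indep_A3end.
- by symmetry; apply: indep_A1A2 => //; exact: sym.
- by symmetry; apply: indep_A3end => //; exact: sym.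
- have [cqt|/ltW ctq] := leP (c q u) (c t u); first exact: indep_A3center.
  by symmetry; apply: indep_A3center => //; exact: sym.
- by case: htri; exists s, t, q; split; exact: edge3.
Qed.

End Independence.

(** * The polynomials T *)

Section T.
Variables (R : realType) (S : finType) (M : coxeterMatrix S).
Hypotheses (hsmall : small_type M) (htri : no_triangle M).

Local Notation al := (simple_root R).
Local Notation c s u := (form M (simple_root R s) u).
Local Notation r := (@reflection S M R).
Local Notation U := (rootspace S R).
Local Notation ranked := (@ranked R S M).

Lemma ranked_not_simple n s u : ranked n u -> (1 < n)%N -> u <> al s.
Proof.
by move=> Pu n1 us; move: Pu n1; rewrite us => /(ranked_simple hsmall) ->.
Qed.

Lemma ranked_gt0_rank n u : ranked n u -> (0 < n)%N.
Proof. by case. Qed.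

Lemma rank_down n s u : ranked n u -> 0 < c s u -> u <> al s -> ranked n.-1 (r s u).
Proof. by move=> Pu cu us; have [k -> Pk] := ranked_down hsmall Pu cu us. Qed.

(** Turns the test by which [T_rec] chooses [t] into a sign condition. *)
Lemma depth_refl_down n t u : ranked n u -> (1 < n)%N ->
  (depth M (r t u) == (depth M u).-1) = (0 < c t u).
Proof.
move=> Pu n1; have ut := ranked_not_simple Pu n1.
rewrite (depth_ranked hsmall Pu).
have [cu|cu|cu] := ltgtP (c t u) 0.
- by rewrite (depth_ranked hsmall (ranked_up Pu cu)); apply/negbTE; lia.
- by rewrite (depth_ranked hsmall (rank_down Pu cu (ut t))) eqxx.
- by rewrite refl_id // (depth_ranked hsmall Pu); apply/negbTE; lia.
Qed.

Lemma exists_descent n u : ranked n u -> (1 < n)%N -> exists t, 0 < c t u.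
Proof.
case=> // {n u} n s u Pu cu _; exists s; rewrite form_refl_self; lra.
Qed.

Lemma refl_reflE s t u : M s t = 3%N ->
  r s (r t u) = u - (c t u + c s u) *: al s - c t u *: al t.
Proof.
move=> m; rewrite {1}/reflection form_refl3 // /reflection.
by apply/ffunP => x; rewrite !ffunE /GRing.scale /=; ring.
Qed.

(** With a = [- c s u] and b = [c t u], one has [c s (r t u)] = b - a when [M s t = 3], so all
    comparisons of a and b become signs of this pairing. The chosen [t] is the same for every bound
    [n] and every [s]. *)
Lemma T_rec_descent k u : ranked k u -> (1 < k)%N ->
  exists2 t, 0 < c t u & forall n s, T_rec M n.+1 s u =
    if 0 < c s u then 'X^k * ('X - 1)
    else if M s t == 2%N then 'X * T_rec M n s (r t u)
    else if 0 < c s (r t u) then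
      ('X - 1) * T_rec M n s (r t u) + 'X * T_rec M n t (r s (r t u))
    else if c s (r t u) == 0 then
      T_rec M n t (r t u) + ('X - 1) * T_rec M n s (r t u)
    else 'X * T_rec M n s (r t u) + T_rec M n t (r t u)
         + 'X^(k.-1) * (1 - 'X).
Proof.
move=> Pu k1; have kE := depth_ranked hsmall Pu.
have pickE t := depth_refl_down t Pu k1.
case E: {1}_ / (pickP (fun t => depth M (r t u) == (depth M u).-1))
    => [t tP|noP]; last first.
  by have [t ct] := exists_descent Pu k1; have := noP t; rewrite pickE ct.
move: tP; rewrite pickE => ct; exists t => // n s /=; rewrite E kE.
rewrite ifN; last by rewrite neq_ltn k1 orbT.
case: ltgtP => // cs.
  have st : s != t by apply: contraTneq ct => <-; rewrite -leNgt ltW.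
  rewrite form_simple_root; case: (hsmall st) => m; rewrite m /=.
    by rewrite basis_form2 // eqxx.
  rewrite basis_form3 // oppr_eq0 oner_eq0 form_refl3 // refl_reflE //.
  rewrite -[- _ < _]subr_gt0 opprK -[_ == - _]subr_eq0 opprK.
  rewrite (addrC (c t u)); case: ltgtP => _ //.
have st : s != t by apply: contraTneq ct => <-; rewrite cs ltxx.
rewrite form_simple_root; case: (hsmall st) => m; rewrite m /=.
  by rewrite basis_form2 // eqxx.
rewrite basis_form3 // oppr_eq0 oner_eq0 form_refl3 // refl_reflE //.
by rewrite -cs add0r ct addr0.
Qed.

Lemma T_rec_fuel n m k s u : ranked k u -> (k <= n)%N -> (k <= m)%N ->
  T_rec M n s u = T_rec M m s u.
Proof.
elim/ltn_ind: k n m s u => k IH n m s u Pu.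
case: n => [|n]; first by have := ranked_gt0_rank Pu; lia.
case: m => [|m]; first by have := ranked_gt0_rank Pu; lia.
move=> kn km; have [k1|k1] := eqVneq k 1%N.
  by rewrite /= (depth_ranked hsmall Pu) k1.
have {}k1 : (1 < k)%N by have := ranked_gt0_rank Pu; lia.
have [t ct TE] := T_rec_descent Pu k1; rewrite !TE.
have Pt : ranked k.-1 (r t u) := rank_down Pu ct (ranked_not_simple Pu k1).
have IHt x : T_rec M n x (r t u) = T_rec M m x (r t u).
  by apply: IH Pt _ _; lia.
case: ifP => // /negbT cs; rewrite -leNgt in cs.
case: ifP => m2; first by rewrite IHt.
case: ifP => cst; last by rewrite !IHt.
rewrite IHt; congr (_ + _ * _).
(* The call at [r s (r t u)] is two ranks below [u] unless [r t u = al s]; that would force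
   [c s u = 1], against [c s u <= 0]. *)
have us : r t u <> al s.
  move=> us.
  have st : s != t by apply: contraTneq ct => <-; rewrite -leNgt.
  have m3 : M s t = 3%N by case: (hsmall st) => // m2'; rewrite m2' in m2.
  have m3' : M t s = 3%N by rewrite cox_sym.
  have := form_refl_self M t u; rewrite us form_simple3 //.
  have := form_refl3 u m3; rewrite us form_simple_self; lra.
by apply: IH (rank_down Pt cst us) _ _; lia.
Qed.

Lemma T_poly_simple s t : T_poly M s (al t) = if s == t then 'X^2 else 0.
Proof.
have d1 : depth M (al t) = 1%N by apply: depth_ranked => //; exact: ranked1.
rewrite /T_poly d1 /= d1 eqxx (inj_eq (@simple_root_inj R S)) eq_sym.
by [].
Qed.

Lemma T_poly_pos n s u : ranked n u -> 0 < c s u -> u <> al s ->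
  T_poly M s u = 'X^n * ('X - 1).
Proof.
move=> Pu cs us; have n1 : (1 < n)%N.
  case: Pu cs us => [t|{}n t v Pv cv _ _]; last first.
    by have := ranked_gt0_rank Pv; lia.
  have [-> _ /(_ erefl)[]|/(form_simple_le0 R hsmall) ? ? _] := eqVneq s t.
  by exfalso; lra.
rewrite /T_poly (depth_ranked hsmall Pu); case: n n1 Pu => // n n1 Pu.
by have [t _ ->] := T_rec_descent Pu n1; rewrite cs.
Qed.

(* u |-> y^dp(u) is invariant under phi_s away from alpha_s; subtracting this
   multiple of it makes the recursion for T homogeneous. *)
Definition kap s (u : U) : {poly rat} := T_poly M s u - 'X^(depth M u) * ('X - 1).

Lemma kap_pos n s u : ranked n u -> 0 < c s u -> u <> al s -> kap s u = 0.
Proof.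
move=> Pu cs us; rewrite /kap (T_poly_pos Pu) // (depth_ranked hsmall Pu).
by rewrite subrr.
Qed.

Lemma kap_simple s t : s != t -> kap s (al t) = 'X * (1 - 'X).
Proof.
move=> /negPf st; rewrite /kap T_poly_simple st.
by rewrite (depth_ranked hsmall (ranked1 R M t)); ring.
Qed.

Lemma kap_simple_self s : kap s (al s) = 'X.
Proof.
rewrite /kap T_poly_simple eqxx (depth_ranked hsmall (@ranked1 R S M s)); ring.
Qed.

Local Notation descent := (descent M (fun s u => c s u) r kap).

(** Otherwise [u] would be [al s + al t], whose pairing with [al s] is 1. *)
Lemma refl_not_simple s t u : M s t = 3%N -> 0 < c t u -> c s u <= 0 ->
  r t u <> al s.
Proof.
move=> m ct cs us; have m' : M t s = 3%N by rewrite cox_sym.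
have := form_refl_self M t u; rewrite us form_simple3 //.
have := form_refl3 u m; rewrite us form_simple_self; lra.
Qed.

Local Arguments T_rec : simpl never.

Lemma kap_pick n u : ranked n u -> (1 < n)%N ->
  exists2 t, 0 < c t u & forall s, c s u <= 0 -> kap s u = descent s t u.
Proof.
move=> Pu n1; have [t ct TE] := T_rec_descent Pu n1; exists t => // s cs.
have Pt : ranked n.-1 (r t u) := rank_down Pu ct (ranked_not_simple Pu n1).
have TtE x : T_rec M n.-1 x (r t u) = T_poly M x (r t u).
  by rewrite /T_poly (depth_ranked hsmall Pt).
have dE : depth M (r t u) = n.-1 by rewrite (depth_ranked hsmall Pt).
case: n Pt Pu n1 TE TtE dE => [|[|n]] // Pt Pu n1 TE TtE dE; rewrite /= in TtE dE.
rewrite /kap /T_poly (depth_ranked hsmall Pu) TE ltNge cs /= /descent.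
have st : s != t by apply: contraTneq ct => <-; rewrite -leNgt.
case: (hsmall st) => m; rewrite m /=.
  by rewrite TtE /kap dE !exprS; ring.
case: ifP => [cst|_]; last first.
  by case: ifP => _; rewrite !TtE /kap dE !exprS; ring.
have us := refl_not_simple m ct cs.
have Pst : ranked n (r s (r t u)) := rank_down Pt cst us.
have -> : T_rec M n.+1 t (r s (r t u)) = T_poly M t (r s (r t u)).
  rewrite /T_poly (depth_ranked hsmall Pst).
  exact: (T_rec_fuel _ Pst).
(* Since [c s (r t u) > 0], the term [T_poly M s (r t u)] is explicit and is absorbed by the
   subtracted power of y; only the term in [t] survives. *)
by rewrite TtE (T_poly_pos Pt) // /kap (depth_ranked hsmall Pst) !exprS; ring.
Qed.

Lemma T_polyE s (u : U) :
  T_poly M s u = kap s u + 'X^(depth M u) * ('X - 1).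
Proof. by rewrite /kap subrK. Qed.

(* Otherwise unification unfolds the recursion on the depth. *)
Local Opaque kap T_poly depth reflection form simple_root.

(** Strong induction on the rank: [kap_pick] gives the recursion for the chosen [q], and
    [descent_indep], fed with the induction hypothesis at the roots of [B], carries it over to
    [t]. *)
Lemma kap_descent n u : ranked n u -> forall s t,
  0 < c t u -> u <> al t -> c s u <= 0 -> kap s u = descent s t u.
Proof.
elim/ltn_ind: n u => n IH u Pu s t ct ut cs.
have n1 : (1 < n)%N.
  case: n u / Pu ct ut {cs IH} => [q|n q v Pv cv _ _]; last first.
    by have := ranked_gt0_rank Pv; lia.
  have [-> _ /(_ erefl)[]|/(form_simple_le0 R hsmall) ? ? _] := eqVneq t q.
  by exfalso; lra.
have [q cq qE] := kap_pick Pu n1; rewrite (qE s cs).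
have [->|tq] := eqVneq t q; first by reflexivity.
have uq := ranked_not_simple (s:=q) Pu n1.
have st : s != t by apply: contraTneq ct => <-; rewrite -leNgt.
have sq : s != q by apply: contraTneq cq => <-; rewrite -leNgt.
pose B v := exists2 m, (m < n)%N & ranked m v.
have Bd x v : B v -> falls al (fun s u => c s u) x v -> B (r x v).
  move=> [m mn Pv] [cv xv]; have [k mk Pk] := ranked_down hsmall Pv cv xv.
  by exists k => //; lia.
have Pn x : 0 < c x u -> u <> al x -> B (r x u).
  by move=> cx ux; exists n.-1; [lia | exact: rank_down].
have KB x y v : B v -> falls al (fun s u => c s u) y v -> c x v <= 0 ->
    kap x v = descent x y v.
  by move=> [m mn Pv] [cv xv] cxv; apply: (IH _ mn _ Pv).
apply: (@descent_indep R S M U al (fun s u => c s u) r _ _ _ _ _ _ _ _ _ _ kap B).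
- exact: reflectionK.
- exact: form_simple_self.
- exact: form_simple2.
- exact: form_simple3.
- exact: form_refl_self.
- exact: form_refl2.
- exact: form_refl3.
- exact: refl_refl_simple3.
- exact: refl_comm.
- exact: refl_braid.
- exact: Bd.
- exact: KB.
- exact: kap_simple.
- exact: hsmall.
- exact: htri.
- exact: sq.
- exact: st.
- by rewrite eq_sym tq.
- by apply: Pn => //; exact: uq.
- exact: Pn.
- exact: cq.
- exact: ct.
- exact: cs.
Qed.

(** When [c s u > 0] both sides vanish by [kap_pos]; otherwise this is [kap_descent]. *)
Lemma kap2 n s t u : ranked n u -> M s t = 2%N -> 0 < c t u -> u <> al t ->
  kap s u = 'X * kap s (r t u).
Proof.
move=> Pu m ct ut; have m' : M t s = 2%N by rewrite cox_sym.
have [cs|cs] := leP (c s u) 0.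
  by rewrite (kap_descent Pu ct ut cs) /descent m.
have us : u <> al s by move=> us; move: ct; rewrite us form_simple2 ?ltxx.
have tus : r t u <> al s.
  move=> tus; apply: us.
  by rewrite -(reflectionK M t u) tus refl_id // form_simple2.
rewrite (kap_pos Pu cs us) (kap_pos (rank_down Pu ct ut)) ?mulr0 //.
by rewrite form_refl2.
Qed.

Lemma kap3_gt0 n s t u : ranked n u -> M s t = 3%N -> 0 < c t u -> u <> al t ->
  c s u <= 0 -> 0 < c s u + c t u -> kap s u = 'X * kap t (r s (r t u)).
Proof.
move=> Pu m ct ut cs st; rewrite (kap_descent Pu ct ut cs) descent3_gt0 //.
by move=> x y v; exact: form_refl3.
Qed.

Lemma kap3_eq0 n s t u : ranked n u -> M s t = 3%N -> 0 < c t u -> u <> al t ->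
  c s u <= 0 -> c s u + c t u = 0 ->
  kap s u = kap t (r t u) + ('X - 1) * kap s (r t u).
Proof.
move=> Pu m ct ut cs st; rewrite (kap_descent Pu ct ut cs) descent3_eq0 //.
by move=> x y v; exact: form_refl3.
Qed.

Lemma kap3_lt0 n s t u : ranked n u -> M s t = 3%N -> 0 < c t u -> u <> al t ->
  c s u <= 0 -> c s u + c t u < 0 ->
  kap s u = 'X * kap s (r t u) + kap t (r t u).
Proof.
move=> Pu m ct ut cs st; rewrite (kap_descent Pu ct ut cs) descent3_lt0 //.
by move=> x y v; exact: form_refl3.
Qed.

(** Settles the braid condition at roots fixed by [s] and [t], where [phi_s] and [phi_t] act
    trivially. The proof descends through some [q], which differs from [s] and [t]. *)
Lemma kap_sym n s t u : ranked n u -> M s t = 3%N -> c s u = 0 -> c t u = 0 ->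
  kap s u = kap t u.
Proof.
elim/ltn_ind: n s t u => n IH s t u Pu m cs ct.
have m' : M t s = 3%N by rewrite cox_sym.
have [n1|n1] := leqP n 1.
  have [q uq] : exists q, u = al q.
    case: Pu n1 {IH cs ct} => [q _|k q v Pv cv]; first by exists q.
    by have := ranked_gt0_rank Pv; lia.
  rewrite uq in cs ct *.
  have neq x : c x (al q) = 0 -> x != q.
    by move=> cx; apply/eqP => xq; move: cx; rewrite xq form_simple_self; lra.
  by rewrite !kap_simple ?neq.
have [q cq] := exists_descent Pu n1; have uq := ranked_not_simple (s := q) Pu n1.
have sq : s != q by apply: contraTneq cq => <-; rewrite cs ltxx.
have tq : t != q by apply: contraTneq cq => <-; rewrite ct ltxx.
have Pq : ranked n.-1 (r q u) := rank_down Pu cq uq.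
(* There is no triangle, so [q] commutes with [s] or with [t], and these two are interchangeable. *)
wlog sq2 : s t m m' cs ct sq tq / M s q = 2%N.
  move=> H; have [sq2|sq3] := hsmall sq; first exact: H.
  have [tq2|tq3] := hsmall tq; first by symmetry; exact: H.
  by case: htri; exists s, t, q; split; exact: edge3.
rewrite (kap2 Pu sq2) //.
have qs2 : M q s = 2%N by rewrite cox_sym.
have [tq2|tq3] := hsmall tq.
  by rewrite (kap2 Pu tq2) //; congr (_ * _); apply: (IH n.-1) Pq _ _ _;
     rewrite ?form_refl2 //; lia.
have qt3 : M q t = 3%N by rewrite cox_sym.
have ct' : 0 < c t (r q u) by rewrite form_refl3 // ct add0r.
have qut : r q u <> al t.
  move=> E; have := cs; rewrite -(reflectionK M q u) E form_refl2 //.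
  by rewrite form_simple3 //; lra.
have Ptq := rank_down Pq ct' qut.
have cs' : 0 < c s (r t (r q u)).
  by rewrite form_refl3 // form_refl2 // cs add0r.
have tqs : r t (r q u) <> al s.
  move=> E; have := cs; rewrite -(reflectionK M q u) -(reflectionK M t (r q u)).
  by rewrite E form_refl2 // form_refl3 // form_simple_self form_simple3 //; lra.
have Pstq := rank_down Ptq cs' tqs.
have -> : kap t u = 'X * kap q (r t (r q u)).
  by apply: (kap3_gt0 Pu tq3 cq uq); rewrite ct ?add0r.
have -> : kap q (r t (r q u)) = 'X * kap q (r s (r t (r q u))).
  exact: (kap2 Ptq qs2 cs' tqs).
have -> : kap s (r q u) = 'X * kap t (r s (r t (r q u))).
  by apply: (kap3_gt0 Pq m ct' qut); rewrite form_refl2 // cs ?add0r.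
(* In A3 with middle node [t], both polynomials reduce to the root [r s (r t (r q u))], three levels
   down, where the claim is needed for the pair [t], [q]. *)
congr (_ * (_ * _)); apply: (IH _ _ t q _ Pstq tq3); first by lia.
  by rewrite !(form_refl3 _ m, form_refl3 _ m', form_refl3 _ tq3,
    form_refl2 _ sq2, form_refl_self); lra.
by rewrite !(form_refl2 _ qs2, form_refl3 _ tq3, form_refl3 _ qt3,
  form_refl_self); lra.
Qed.

(* The transpose of phi_s acting on functions on positive roots. *)
Definition phiT s (f : U -> {poly rat}) u : {poly rat} :=
  if u == al s then 0
  else if c s u == 0 then f u
  else if 0 < c s u then 'X * f (r s u)
  else (1 - 'X) * f u + f (r s u).

(** A negative pairing lets the recursion for [kap] be read upwards, from the reflected root back to
    [u]; a positive one makes [kap] vanish away from the simple root. *)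
Lemma phiT_kap n s t u : ranked n u -> M s t = 3%N -> u <> al s -> u <> al t ->
  phiT s (kap t) u = phiT t (kap s) u.
Proof.
move=> Pu m us ut; rewrite /phiT.
move/eqP/negPf: (us) => ->; move/eqP/negPf: (ut) => ->.
have m' : M t s = 3%N by rewrite cox_sym.
have up x : c x u < 0 -> ranked n.+1 (r x u) := fun cx => rankedS Pu cx.
have upn x y : c x u < 0 -> r x u <> al y.
  move=> cx; apply: ranked_not_simple (up _ cx) _.
  by have := ranked_gt0_rank Pu; lia.
wlog cst : s t us ut m m' / c t u <= c s u.
  by move=> H; have [|/ltW] := leP (c t u) (c s u) => ?; [|symmetry]; exact: H.
have [cs|cs|cs] := ltgtP (c s u) 0.
- have ct : c t u < 0 by exact: le_lt_trans cs.
  rewrite (lt_eqF ct) ltNge (ltW ct) /=.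
  have kapE x y : M x y = 3%N -> c x u < 0 -> c y u < 0 ->
      kap x (r y u) = 'X * kap x u + kap y u.
    move=> xy cx cy; have := @kap3_lt0 _ x y _ (up y cy) xy.
    rewrite reflectionK form_refl_self form_refl3 //.
    by apply; [lra | exact: upn | lra | lra].
  by rewrite (kapE t s) // (kapE s t) //; ring.
- rewrite (kap_pos Pu cs us).
  have su_t : r s u = al t -> c t u = 1.
    move=> E; rewrite -(reflectionK M s u) E form_refl3 //.
    by rewrite form_simple_self form_simple3 //; lra.
  have [ct|ct|ct] := ltgtP (c t u) 0.
  + rewrite mulr0 add0r.
    (* The sum is both [c s (r t u)] and [c t (r s u)]; when it is positive, both sides vanish. *)
    have [cst1|cst1] := leP (c s u + c t u) 0.
      have := @kap3_gt0 _ s t _ (up t ct) m.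
      rewrite reflectionK form_refl_self form_refl3 // => ->//; last by lra.
      - by lra.
      - exact: upn.
    rewrite (kap_pos (up _ ct)) ?form_refl3 //; last exact: upn.
    rewrite (kap_pos (rank_down Pu cs us)) ?mulr0 ?form_refl3 //; first by lra.
    by move/su_t; lra.
  (* The root [al s + al t] is set apart: its reflections are [al t] and [al s], where [kap] has the
     nonzero value y instead of vanishing. *)
  + have [E|/eqP nE] := eqVneq (r s u) (al t).
      have -> : r t u = al s.
        by rewrite -(reflectionK M s u) E refl_refl_simple3.
      by rewrite E !kap_simple_self.
    have nE' : r t u <> al s.
      move=> E; apply: nE.
      by rewrite -(reflectionK M t u) E refl_refl_simple3.
    rewrite (kap_pos (rank_down Pu cs us)) ?(kap_pos (rank_down Pu ct ut)) //;
      by rewrite form_refl3 //; lra.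
  + rewrite (kap_pos (rank_down Pu cs us)) ?mulr0 ?form_refl3 ?ct ?add0r //.
    by move/su_t; lra.
- have [ct|ct|ct] := ltgtP (c t u) 0; last by rewrite (kap_sym Pu m).
    have -> : kap s (r t u) = kap t u + ('X - 1) * kap s u.
      have := @kap3_eq0 _ s t _ (up t ct) m.
      rewrite reflectionK form_refl_self form_refl3 //.
      by apply; [lra | exact: upn | lra | lra].
    by ring.
  by move: (lt_le_trans ct cst); rewrite cs ltxx.
Qed.

Lemma phiT_depth n s u : ranked n u -> u <> al s ->
  phiT s (fun v => 'X^(depth M v)) u = 'X^(depth M u).
Proof.
move=> Pu us; rewrite /phiT; move/eqP/negPf: (us) => ->.
have [cs|cs|cs] := ltgtP (c s u) 0 => //.
  rewrite (depth_ranked hsmall (ranked_up Pu cs)) (depth_ranked hsmall Pu).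
  by rewrite exprS; ring.
rewrite (depth_ranked hsmall (rank_down Pu cs us)) (depth_ranked hsmall Pu).
by case: n Pu => [/ranked_gt0_rank //|n _]; rewrite exprS.
Qed.

Lemma phiTD s f g a u :
  phiT s (fun v => f v + g v * a) u = phiT s f u + phiT s g u * a.
Proof.
by rewrite /phiT; case: ifP => _; [|case: ifP => _; [|case: ifP => _]]; ring.
Qed.

Lemma phiT_T n s t u : ranked n u -> u <> al s ->
  phiT s (T_poly M t) u = phiT s (kap t) u + 'X^(depth M u) * ('X - 1).
Proof.
move=> Pu us; rewrite -(phiT_depth Pu us) -phiTD.
by congr phiT; apply/funext => v; exact: T_polyE.
Qed.

Lemma phiT_self s f : phiT s f (al s) = 0.
Proof. by rewrite /phiT eqxx. Qed.

(** The two terms are (1 - y) y^2 from [al s] and y^2 (y - 1) from [al s + al t], and they cancel.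
    This fixes the value y^2 of T at its own simple root. *)
Lemma phiT_T_simple s t : M s t = 3%N -> phiT t (T_poly M s) (al s) = 0.
Proof.
move=> m; have m' : M t s = 3%N by rewrite cox_sym.
have ct : c t (al s) < 0 by rewrite form_simple3 //; lra.
have st : s != t by apply: (@M_neq _ M); rewrite m.
rewrite /phiT (inj_eq (@simple_root_inj R S)) (negPf st) (lt_eqF ct).
rewrite ltNge (ltW ct) /= T_poly_simple eqxx.
rewrite (T_poly_pos (ranked_up (ranked1 R M s) ct)).
- ring.
- by rewrite form_refl3 // form_simple_self form_simple3 //; lra.
- exact: ranked_not_simple (ranked_up (ranked1 R M s) ct) _.
Qed.

Lemma phiT_braid n s t u : ranked n u -> M s t = 3%N ->
  phiT s (T_poly M t) u = phiT t (T_poly M s) u.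
Proof.
move=> Pu m; have m' : M t s = 3%N by rewrite cox_sym.
have [->|/eqP us] := eqVneq u (al s); first by rewrite phiT_self phiT_T_simple.
have [->|/eqP ut] := eqVneq u (al t); first by rewrite phiT_self phiT_T_simple.
by rewrite (phiT_T t Pu us) (phiT_T s Pu ut) (phiT_kap Pu m).
Qed.

Lemma phiT_comm n s t u : ranked n u -> M s t = 2%N ->
  phiT t (T_poly M s) u = T_poly M s u.
Proof.
move=> Pu m; have m' : M t s = 2%N by rewrite cox_sym.
have [->|/eqP ut] := eqVneq u (al t).
  rewrite phiT_self T_poly_simple ifN //.
  by apply: (@M_neq _ M); rewrite m.
rewrite (phiT_T _ Pu ut) T_polyE; congr (_ + _).
rewrite /phiT; move/eqP/negPf: (ut) => ->.
have [ct|ct|//] := ltgtP (c t u) 0; last by rewrite (kap2 Pu m ct ut).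
rewrite (kap2 (ranked_up Pu ct) m) ?reflectionK ?form_refl_self ?oppr_gt0 //.
  ring.
by apply: ranked_not_simple (ranked_up Pu ct) _; have := ranked_gt0_rank Pu; lia.
Qed.

End T.

(** * The representation *)

Section FreeModule.
Variables (K : fieldType) (B : choiceType).
Local Notation F := {freeg B / K}.

Lemma linear_map0 (W1 W2 : lmodType K) (f : W1 -> W2) : linear f -> f 0 = 0.
Proof.
move=> lf; have := lf 1 0 0; rewrite scaler0 addr0 scale1r => E.
by apply: (addrI (f 0)); rewrite addr0 -E.
Qed.

Lemma linear_map_sum (W1 W2 : lmodType K) (f : W1 -> W2) (I : Type) (d : seq I)
  (a : I -> K) (w : I -> W1) : linear f ->
  f (\sum_(i <- d) a i *: w i) = \sum_(i <- d) a i *: f (w i).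
Proof.
move=> lf; elim: d => [|i d IH]; first by rewrite !big_nil linear_map0.
by rewrite !big_cons lf IH.
Qed.

Lemma freeg_basisE (v : F) : v = \sum_(z <- dom v) coeff z v *: << z >>.
Proof.
rewrite -[LHS]freeg_sumE; apply: eq_bigr => z _.
by apply/eqP/freeg_eqP => z'; rewrite coeffZ !coeffU mul1r.
Qed.

Lemma freeg_linear_ext (W : lmodType K) (f g : F -> W) :
  linear f -> linear g -> (forall b, f << b >> = g << b >>) -> f =1 g.
Proof.
move=> lf lg fg v; rewrite (freeg_basisE v) !linear_map_sum //.
by apply: eq_bigr => z _; rewrite fg.
Qed.

Lemma fglift_linear (W : lmodType K) (f : B -> W) : linear (fglift f).
Proof.
have fB : forall u v : F, fglift f (u - v) = fglift f u - fglift f v.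
  exact: lift_is_additive.
have f0 : fglift f 0 = 0 by rewrite -(subrr (0 : F)) fB subrr.
have fN (v : F) : fglift f (- v) = - fglift f v by rewrite -sub0r fB f0 sub0r.
have fD (u v : F) : fglift f (u + v) = fglift f u + fglift f v.
  by rewrite -{1}(opprK v) fB fN opprK.
have fS (I : Type) (d : seq I) (w : I -> F) :
    fglift f (\sum_(i <- d) w i) = \sum_(i <- d) fglift f (w i).
  by elim: d => [|i d IH]; rewrite ?big_nil // !big_cons fD IH.
move=> a u v; rewrite fD; congr (_ + _).
have -> : a *: u = \sum_(z <- dom u) << a * coeff z u *g z >> by [].
rewrite fS -[in RHS](freeg_sumE u) fS scaler_sumr.
by apply: eq_bigr => z _; rewrite !liftU scalerA.
Qed.

Lemma linear_mapZ (W1 W2 : lmodType K) (f : W1 -> W2) a v : linear f ->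
  f (a *: v) = a *: f v.
Proof. by move=> lf; rewrite -[a *: v]addr0 lf linear_map0 ?addr0. Qed.

Lemma linear_mapD (W1 W2 : lmodType K) (f : W1 -> W2) v w : linear f ->
  f (v + w) = f v + f w.
Proof. by move=> lf; rewrite -{1}[v]scale1r lf scale1r. Qed.

Lemma freeg_ext (v w : F) : (forall b, coeff b v = coeff b w) -> v = w.
Proof. by move=> vw; apply/eqP/freeg_eqP. Qed.

Lemma linear_lin2 (f : F -> F) a b v w : linear f ->
  f (a *: v + b *: w) = a *: f v + b *: f w.
Proof. by move=> lf; rewrite lf linear_mapZ. Qed.

(** The vectors stand for [u], [r s u], [r t u], [r s (r t u)], [r t (r s u)] and the image of [u]
    under the longest element; they may coincide. The three final equations match the coefficients
    of [e0], [e1], [e2], and the remaining coefficients agree identically. *)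
Lemma braid_of_coefficients (P Q : F -> F) (e0 e1 e2 e12 e21 e3 : F)
  (a b a' b' a1 b1 a1' b1' d f : K) : linear P -> linear Q ->
  P e0 = a *: e0 + b *: e1 -> Q e0 = a' *: e0 + b' *: e2 ->
  Q e1 = d *: e1 + f *: e21 -> P e2 = d *: e2 + f *: e12 ->
  P e1 = a1 *: e1 + b1 *: e0 -> Q e2 = a1' *: e2 + b1' *: e0 ->
  P e21 = a' *: e21 + b' *: e3 -> Q e12 = a *: e12 + b *: e3 ->
  a ^+ 2 * a' + b * d * b1 = a' ^+ 2 * a + b' * d * b1' ->
  a * a' * b + b * d * a1 = a' * b * d ->
  a' * a * b' + b' * d * a1' = a * b' * d ->
  P (Q (P e0)) = Q (P (Q e0)).
Proof.
move=> lP lQ P0 Q0 Q1 P2 P1 Q2 P21 Q12 E0 E1 E2.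
rewrite P0 Q0 !(linear_lin2 _ _ _ _ lP, linear_lin2 _ _ _ _ lQ).
rewrite P0 Q0 Q1 P2 !(linear_lin2 _ _ _ _ lP, linear_lin2 _ _ _ _ lQ).
rewrite P0 Q0 P1 Q1 P2 Q2 P21 Q12.
apply: freeg_ext => z; rewrite !(coeffD, coeffZ).
set z0 := coeff z e0; set z1 := coeff z e1; set z2 := coeff z e2.
apply/eqP; rewrite -subr_eq0; apply/eqP.
transitivity ((a ^+ 2 * a' + b * d * b1 - (a' ^+ 2 * a + b' * d * b1')) * z0
  + (a * a' * b + b * d * a1 - a' * b * d) * z1
  - (a' * a * b' + b' * d * a1' - a * b' * d) * z2); first by ring.
by rewrite E0 E1 E2 !subrr !mul0r subr0 addr0.
Qed.

Lemma comm_of_coefficients (P Q : F -> F) (e0 e1 e2 e3 : F) (a b a' b' : K) :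
  linear P -> linear Q ->
  P e0 = a *: e0 + b *: e1 -> Q e0 = a' *: e0 + b' *: e2 ->
  Q e1 = a' *: e1 + b' *: e3 -> P e2 = a *: e2 + b *: e3 ->
  P (Q e0) = Q (P e0).
Proof.
move=> lP lQ P0 Q0 Q1 P2.
rewrite P0 Q0 (linear_lin2 _ _ _ _ lP) (linear_lin2 _ _ _ _ lQ) P0 Q0 Q1 P2.
by apply: freeg_ext => z; rewrite !(coeffD, coeffZ); ring.
Qed.

Lemma hecke_of_coefficients (P : F -> F) (e0 e1 : F) (a b a1 b1 y : K) :
  linear P -> P e0 = a *: e0 + b *: e1 -> P e1 = a1 *: e1 + b1 *: e0 ->
  a ^+ 2 + b * b1 = (1 - y) * a + y -> a * b + b * a1 = (1 - y) * b ->
  P (P e0) = (1 - y) *: P e0 + y *: e0.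
Proof.
move=> lP P0 P1 E0 E1; rewrite P0 (linear_lin2 _ _ _ _ lP) P0 P1.
apply: freeg_ext => z; rewrite !(coeffD, coeffZ).
set z0 := coeff z e0; set z1 := coeff z e1.
transitivity ((a ^+ 2 + b * b1) * z0 + (a * b + b * a1) * z1); first by ring.
by rewrite E0 E1; ring.
Qed.

(** In the expansion every correction is a multiple of [es], [et] or [est]. The cross terms of [f]
    and [g] vanish, [g] after [P] is replaced by [f] after [Q], and the quadratic relations reduce
    the squares of [P] and [Q]. *)
Lemma braid_of_perturbation (P Q A B' : F -> F) (f g : F -> K^o) (es et est : F)
  (x y : K) : linear P -> linear Q -> linear f -> linear g ->
  (forall v, A v = P v + (x * f v) *: es) ->
  (forall v, B' v = Q v + (x * g v) *: et) ->
  (forall v, P (Q (P v)) = Q (P (Q v))) ->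
  P et = (1 - y) *: et + est -> Q es = (1 - y) *: es + est ->
  P (Q es) = y *: et -> Q (P et) = y *: es ->
  f et = 0 -> g es = 0 -> f (Q es) = 0 -> g (P et) = 0 ->
  (forall v, g (P v) = f (Q v)) ->
  (forall v, g (P (P v)) = (1 - y) * g (P v) + y * g v) ->
  (forall v, f (Q (Q v)) = (1 - y) * f (Q v) + y * f v) ->
  forall v, A (B' (A v)) = B' (A (B' v)).
Proof.
move=> lP lQ lf lg AE BE PQ Pt Qs PQs QPt ft gs fQs gPt gf hg hf v.
rewrite !(AE, BE).
rewrite !(linear_mapD _ _ lP, linear_mapD _ _ lQ, linear_mapD _ _ lf,
  linear_mapD _ _ lg, linear_mapZ _ _ lP, linear_mapZ _ _ lQ,
  linear_mapZ _ _ lf, linear_mapZ _ _ lg).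
rewrite ft gs fQs gPt PQs QPt Pt Qs PQ.
rewrite -(gf (P v)) hg (gf (Q v)) hf gf.
apply: freeg_ext => z; rewrite !(coeffD, coeffZ) /GRing.scale /=.
ring.
Qed.

Lemma comm_of_perturbation (P Q A B' : F -> F) (f g : F -> K^o) (es et : F)
  (x : K) : linear P -> linear Q -> linear f -> linear g ->
  (forall v, A v = P v + (x * f v) *: es) ->
  (forall v, B' v = Q v + (x * g v) *: et) ->
  (forall v, P (Q v) = Q (P v)) -> P et = et -> Q es = es ->
  f et = 0 -> g es = 0 ->
  (forall v, f (Q v) = f v) -> (forall v, g (P v) = g v) ->
  forall v, A (B' v) = B' (A v).
Proof.
move=> lP lQ lf lg AE BE PQ Pt Qs ft gs fQ gP v.
rewrite !(AE, BE).
rewrite !(linear_mapD _ _ lP, linear_mapD _ _ lQ, linear_mapD _ _ lf,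
  linear_mapD _ _ lg, linear_mapZ _ _ lP, linear_mapZ _ _ lQ,
  linear_mapZ _ _ lf, linear_mapZ _ _ lg).
rewrite ft gs Pt Qs PQ fQ gP.
apply: freeg_ext => z; rewrite !(coeffD, coeffZ) /GRing.scale /=.
ring.
Qed.

Lemma quadratic_of_perturbation (P A : F -> F) (f : F -> K^o) (es e : F)
  (x y : K) : linear P -> linear f ->
  (forall v, A v = P v + (x * f v) *: es) -> P es = 0 ->
  P (P e) = (1 - y) *: P e + y *: e ->
  exists l, A (A e) = (1 - y) *: A e + y *: e + l *: es.
Proof.
move=> lP lf AE Ps PP; exists (x * f (A e) - (1 - y) * (x * f e)).
rewrite [A (A e)]AE; set l := f (A e); rewrite AE.
rewrite (linear_mapD _ _ lP) (linear_mapZ _ _ lP) Ps PP.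
by apply: freeg_ext => z; rewrite !(coeffD, coeffZ, coeff0); ring.
Qed.

Lemma quadratic_of_eigenvector (A : F -> F) (es : F) (a b d : K) : linear A ->
  A es = d *: es -> exists l, A (A es) = a *: A es + b *: es + l *: es.
Proof.
move=> lA As; exists (d ^+ 2 - a * d - b); rewrite !As (linear_mapZ _ _ lA) As.
by apply: freeg_ext => z; rewrite !(coeffD, coeffZ); ring.
Qed.

(** A^2 - a A - b maps into the line of [es], which A - d kills. The product of the two factors is a
    cubic with constant term b d, so the inverse is a polynomial in A. *)
Lemma bijective_of_quadratic (A : F -> F) (es : F) (a b d : K) :
  linear A -> b * d != 0 -> A es = d *: es ->
  (forall z, exists l, A (A << z >>) = a *: A << z >> + b *: << z >> + l *: es) ->
  bijective A.
Proof.
move=> lA d0 As AA.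
have lAN v : A (- v) = - A v by rewrite -scaleN1r (linear_mapZ _ _ lA) scaleN1r.
have A3 v : A (A (A v)) =
    (a + d) *: A (A v) + (b - a * d) *: A v - (b * d) *: v.
  move: v; apply: freeg_linear_ext.
  - by move=> k v w; rewrite !lA.
  - move=> k v w; rewrite !lA; apply: freeg_ext => z.
    by rewrite !(coeffD, coeffN, coeffZ); ring.
  move=> z; set e := << z >>; have [l E] := AA z; rewrite -/e in E.
  have -> : A (A (A e)) = a *: A (A e) + b *: A e + (l * d) *: es.
    by rewrite {1}E !(linear_mapD _ _ lA) !(linear_mapZ _ _ lA) As scalerA.
  rewrite !E; apply: freeg_ext => z'.
  by rewrite !(coeffD, coeffN, coeffZ); ring.
have E v : (b * d)^-1 *:
    ((a + d) *: A (A v) + (b - a * d) *: A v - A (A (A v))) = v.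
  by rewrite A3 opprB addrC subrK scalerA mulVf // scale1r.
exists (fun v => (b * d)^-1 *:
  ((a + d) *: A v + (b - a * d) *: v - A (A v))) => v.
  exact: E.
by rewrite (linear_mapZ _ _ lA) !(linear_mapD _ _ lA) lAN !(linear_mapZ _ _ lA) E.
Qed.

End FreeModule.

(** * Braid relations and invertibility of the maps on V *)

Section Representation.
Variables (R : realType) (S : finType) (M : coxeterMatrix S).
Hypotheses (hsmall : small_type M) (htri : no_triangle M).

Local Notation al := (simple_root R).
Local Notation c s u := (form M (simple_root R s) u).
Local Notation r := (@reflection S M R).
Local Notation U := (rootspace S R).
Local Notation ranked := (@ranked R S M).
Local Notation V := (V M R).
Local Notation e_ := (@e_ S M R).
Local Notation x := x_Qxy.
Local Notation y := y_Qxy.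

Lemma phi_linear s : linear (phi M s : V -> V).
Proof. exact: fglift_linear. Qed.

Lemma psi_linear s : linear (psi_gen M s : V -> V).
Proof. exact: fglift_linear. Qed.

(** The linear form that makes [psi_gen M s] a rank-one perturbation of [phi M s]. *)
Definition tau s : V -> Qxy^o :=
  fglift (fun b : pos_root M R => Qy_to_Qxy (T_poly M s (val b)) : Qxy^o).

Lemma tau_linear s : linear (tau s).
Proof. exact: fglift_linear. Qed.

Lemma e_val (b : pos_root M R) : e_ (val b) = << b >>.
Proof. by rewrite /Defs.e_ valK. Qed.

Lemma e_ranked n u : ranked n u ->
  exists2 b : pos_root M R, val b = u & e_ u = << b >>.
Proof.
move=> Pu; have Pb : `[< is_pos_root M u >].
  by apply/asboolP/(pos_rootP hsmall); exists n.
exists (exist _ u Pb) => //.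
by rewrite -e_val.
Qed.

Lemma V_linear_ext (W : lmodType Qxy) (f g : V -> W) : linear f -> linear g ->
  (forall n u, ranked n u -> f (e_ u) = g (e_ u)) -> f =1 g.
Proof.
move=> lf lg fg; apply: freeg_linear_ext => // b.
have /asboolP/(pos_rootP hsmall)[n Pb] := valP b.
by rewrite -e_val; apply: fg Pb.
Qed.

Lemma phi_e n s u : ranked n u -> phi M s (e_ u) =
  if u == al s then 0
  else if c s u == 0 then e_ u
  else if 0 < c s u then y *: e_ (r s u)
  else (1 - y) *: e_ u + e_ (r s u).
Proof.
move=> Pu; have [b bu ->] := e_ranked Pu.
rewrite /phi liftU scale1r bu scaleNr -/(r s u).
have -> : e_ u = << b >> by rewrite -bu e_val.
by [].
Qed.

Lemma tau_e n s u : ranked n u -> tau s (e_ u) = Qy_to_Qxy (T_poly M s u).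
Proof.
move=> Pu; have [b bu ->] := e_ranked Pu.
by rewrite /tau liftU scale1r bu.
Qed.

Lemma psi_decomp s v : psi_gen M s v =
  phi M s v + (x * tau s v) *: e_ (al s).
Proof.
move: v; apply: V_linear_ext; first exact: psi_linear.
  move=> a v w; rewrite phi_linear tau_linear scalerDr addrACA; congr (_ + _).
  by rewrite mulrDr scalerDl scalerA mulrCA.
move=> n u Pu; rewrite (tau_e _ Pu).
have [b bu ->] := e_ranked Pu.
by rewrite /psi_gen liftU scale1r bu -bu e_val.
Qed.

Lemma QyD : {morph Qy_to_Qxy : p q / p + q}.
Proof. by move=> p q; rewrite /Qy_to_Qxy polyCD tofracD. Qed.
Lemma QyM : {morph Qy_to_Qxy : p q / p * q}.
Proof. by move=> p q; rewrite /Qy_to_Qxy polyCM tofracM. Qed.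
Lemma QyN : {morph Qy_to_Qxy : p / - p}.
Proof. by move=> p; rewrite /Qy_to_Qxy polyCN tofracN. Qed.
Lemma Qy1 : Qy_to_Qxy 1 = 1.
Proof. by rewrite /Qy_to_Qxy tofrac1. Qed.
Lemma Qy0 : Qy_to_Qxy 0 = 0.
Proof. by rewrite /Qy_to_Qxy tofrac0. Qed.

Lemma tau_phi n s t u : ranked n u ->
  tau t (phi M s (e_ u)) = Qy_to_Qxy (phiT M s (T_poly M t) u).
Proof.
move=> Pu; rewrite (phi_e _ Pu) /phiT.
have [us|/eqP us] := eqVneq u (al s).
  by rewrite linear_map0 ?Qy0 //; exact: tau_linear.
have [cs|cs|cs] := ltgtP (c s u) 0; last exact: tau_e Pu.
  rewrite linear_mapD ?linear_mapZ; try exact: tau_linear.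
  rewrite (tau_e _ Pu) (tau_e _ (ranked_up Pu cs)).
  by rewrite QyD QyM QyD QyN Qy1.
rewrite linear_mapZ; last exact: tau_linear.
by rewrite (tau_e _ (rank_down hsmall Pu cs us)) QyM.
Qed.

Lemma x_neq0 : x != 0 :> Qxy.
Proof. by rewrite /x_Qxy tofrac_eq0 polyX_eq0. Qed.

Lemma y_neq0 : y != 0 :> Qxy.
Proof. by rewrite /y_Qxy /Qy_to_Qxy tofrac_eq0 polyC_eq0 polyX_eq0. Qed.

(** [diag] and [offdiag] are the entries of [phi_s] at [u] and at [r s u], as functions of the
    pairing. For pairing zero the two roots coincide, and the whole entry is counted in [diag]. *)
Definition diag (a : R) : Qxy := if a == 0 then 1 else if 0 < a then 0 else 1 - y.
Definition offdiag (a : R) : Qxy := if a == 0 then 0 else if 0 < a then y else 1.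

Lemma phi_diag n s u : ranked n u -> u <> al s -> phi M s (e_ u) =
  diag (c s u) *: e_ u + offdiag (c s u) *: e_ (r s u).
Proof.
move=> Pu /eqP/negPf us; rewrite (phi_e _ Pu) us /diag /offdiag.
have [cs|cs|cs] := ltgtP (c s u) 0.
- by rewrite scale1r.
- by rewrite scale0r add0r.
- by rewrite scale1r scale0r addr0.
Qed.

(** The coefficients of [e_ u] in the two sides of the braid relation; sign patterns that no pair
    [p], [q] realises are refuted linearly. [diag_braid1] does the same for [e_ (r s u)]. *)
Lemma diag_braid0 (p q : R) :
  diag p ^+ 2 * diag q + offdiag p * diag (p + q) * offdiag (- p) =
  diag q ^+ 2 * diag p + offdiag q * diag (p + q) * offdiag (- q).
Proof.
rewrite /diag /offdiag !oppr_eq0 !oppr_gt0.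
have [p0|p0|p0] := ltgtP p 0; have [q0|q0|q0] := ltgtP q 0;
  have [pq|pq|pq] := ltgtP (p + q) 0; try ring; exfalso; lra.
Qed.

Lemma diag_braid1 (p q : R) :
  diag p * diag q * offdiag p + offdiag p * diag (p + q) * diag (- p) =
  diag q * offdiag p * diag (p + q).
Proof.
rewrite /diag /offdiag !oppr_eq0 !oppr_gt0.
have [p0|p0|p0] := ltgtP p 0; have [q0|q0|q0] := ltgtP q 0;
  have [pq|pq|pq] := ltgtP (p + q) 0; try ring; exfalso; lra.
Qed.

Lemma phi_simple_self s : phi M s (e_ (al s)) = 0.
Proof. by rewrite (phi_e _ (ranked1 R M s)) eqxx. Qed.

(** Excludes the three positive roots [al s], [al t], [al s + al t] of the parabolic A2; the rest of
    the positive roots is stable under [s] and [t]. *)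
Definition generic s t u := exists2 n, ranked n u &
  [/\ u <> al s, u <> al t & u <> r s (al t)].

Lemma generic_refl s t u : M s t = 3%N -> generic s t u -> generic s t (r s u).
Proof.
move=> m [n Pu [us ut ust]]; have [k Pk _] := ranked_refl hsmall Pu us.
exists k => //; split=> E.
- case: (rankedN Pu) => z.
  by rewrite -(reflectionK M s u) E refl_simple_self opprK ffunE; case: eqP.
- by apply: ust; rewrite -E reflectionK.
- by apply: ut; rewrite -(reflectionK M s u) E reflectionK.
Qed.

Lemma generic_sym s t u : M s t = 3%N -> generic s t u -> generic t s u.
Proof.
move=> m [n Pu [us ut ust]]; exists n => //; split=> // E; apply: ust.
by rewrite E -{1}(refl_refl_simple3 R m) reflectionK.
Qed.

Lemma phi_generic s t u : generic s t u -> phi M s (e_ u) =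
  diag (c s u) *: e_ u + offdiag (c s u) *: e_ (r s u).
Proof. by move=> [n Pu [us _ _]]; exact: phi_diag Pu us. Qed.

Lemma phiZ s a v : phi M s (a *: v) = a *: (phi M s v : V).
Proof. by apply: linear_mapZ; exact: phi_linear. Qed.
Lemma phiD s v w : phi M s (v + w) = phi M s v + (phi M s w : V).
Proof. by apply: linear_mapD; exact: phi_linear. Qed.
Lemma phi0 s : phi M s 0 = 0 :> V.
Proof. by apply: linear_map0; exact: phi_linear. Qed.
Lemma tauZ s a v : tau s (a *: v) = a * tau s v.
Proof. by apply: linear_mapZ; exact: tau_linear. Qed.
Lemma tauD s v w : tau s (v + w) = tau s v + tau s w.
Proof. by apply: linear_mapD; exact: tau_linear. Qed.

Lemma phi_braid_generic s t u : M s t = 3%N -> generic s t u ->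
  phi M s (phi M t (phi M s (e_ u))) = phi M t (phi M s (phi M t (e_ u))).
Proof.
move=> m Gst; have m' : M t s = 3%N by rewrite cox_sym.
have Gts := generic_sym m Gst.
have Gs := generic_refl m Gst; have Gs' := generic_sym m Gs.
have Gt' := generic_refl m' Gts; have Gt := generic_sym m' Gt'.
have Gst' := generic_refl m Gt; have Gst'' := generic_sym m Gst'.
have Gts'' := generic_refl m' Gs'; have Gts' := generic_sym m' Gts''.
have E := (form_refl_self M, fun v : U => form_refl3 v m,
  fun v : U => form_refl3 v m').
have P0 := phi_generic Gst.
have Q0 := phi_generic Gts.
have Q1 := phi_generic Gs'.
have P2 := phi_generic Gt.
have P1 := phi_generic Gs; rewrite reflectionK in P1.
have Q2 := phi_generic Gt'; rewrite reflectionK in Q2.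
have P21 := phi_generic Gts'.
have Q12 := phi_generic Gst''; rewrite -(refl_braid _ m) in Q12.
have c1 : c t (r s u) = c s u + c t u by rewrite form_refl3 // addrC.
rewrite c1 in Q1; rewrite (form_refl3 _ m) in P2.
rewrite form_refl_self in P1; rewrite form_refl_self in Q2.
rewrite (form_refl33 _ m) in P21; rewrite (form_refl33 _ m') in Q12.
pose F := {freeg (pos_root M R) / Qxy}.
pose P : F -> F := phi M s; pose Q : F -> F := phi M t.
have := @braid_of_coefficients Qxy (pos_root M R) P Q
  (e_ u) (e_ (r s u)) (e_ (r t u)) (e_ (r s (r t u))) (e_ (r t (r s u)))
  (e_ (r s (r t (r s u)))) _ _ _ _ _ _ _ _ _ _ (phi_linear s) (phi_linear t)
  P0 Q0 Q1 P2 P1 Q2 P21 Q12.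
by apply; [exact: diag_braid0 | exact: diag_braid1 |
  rewrite [c s u + _]addrC; exact: diag_braid1].
Qed.

(** At the three positive roots of the parabolic A2 both sides are zero; elsewhere the generic
    computation applies. *)
Lemma phi_braid s t : M s t = 3%N -> forall v : V,
  phi M s (phi M t (phi M s v)) = phi M t (phi M s (phi M t v)).
Proof.
move=> m; have m' : M t s = 3%N by rewrite cox_sym.
have lc (f g : V -> V) : linear f -> linear g -> linear (f \o g).
  by move=> lf lg a v w; rewrite /= lg lf.
apply: V_linear_ext.
- exact: (lc _ _ (phi_linear s) (lc _ _ (phi_linear t) (phi_linear s))).
- exact: (lc _ _ (phi_linear t) (lc _ _ (phi_linear s) (phi_linear t))).
move=> n u Pu.
have wE : r s (al t) = r t (al s).
  by rewrite -(reflectionK M s (r t (al s))) refl_refl_simple3.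
have kill x z : M x z = 3%N -> phi M z (phi M x (e_ (r x (al z)))) = 0 :> V.
  move=> xz; have zx : M z x = 3%N by rewrite cox_sym.
  have cx : c x (al z) < 0 by rewrite form_simple3 //; lra.
  have Pw := ranked_up (ranked1 R M z) cx.
  have cw : 0 < c x (r x (al z)) by rewrite form_refl_self oppr_gt0.
  have wx : r x (al z) <> al x by exact: ranked_not_simple Pw _.
  rewrite (phi_e _ Pw); move/eqP/negPf: wx => ->.
  by rewrite (gt_eqF cw) cw reflectionK phiZ phi_simple_self scaler0.
have simple x z : M x z = 3%N -> phi M z (phi M x (phi M z (e_ (al x)))) = 0 :> V.
  move=> xz; have zx : M z x = 3%N by rewrite cox_sym.
  have xnz : x != z by apply: (@M_neq _ M); rewrite xz.
  have cz : c z (al x) < 0 by rewrite form_simple3 //; lra.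
  rewrite (phi_e _ (ranked1 R M x)) (inj_eq (@simple_root_inj R S)) (negPf xnz).
  rewrite (lt_eqF cz) ltNge (ltW cz) /= phiD phiZ phi_simple_self scaler0 add0r.
  have -> : r z (al x) = r x (al z); last exact: kill.
  by rewrite -(reflectionK M x (r z (al x))) refl_refl_simple3.
have [->|/eqP us] := eqVneq u (al s).
  by rewrite phi_simple_self !phi0 simple.
have [->|/eqP ut] := eqVneq u (al t).
  by rewrite phi_simple_self !phi0 simple.
have [->|/eqP ust] := eqVneq u (r s (al t)).
  by rewrite kill // phi0 wE kill // phi0.
by apply: phi_braid_generic => //; exists n.
Qed.

Lemma phi_comm s t : M s t = 2%N -> forall v : V,
  phi M s (phi M t v) = phi M t (phi M s v).
Proof.
move=> m; have m' : M t s = 2%N by rewrite cox_sym.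
have lc (f g : V -> V) : linear f -> linear g -> linear (f \o g).
  by move=> lf lg a v w; rewrite /= lg lf.
apply: V_linear_ext.
- exact: (lc _ _ (phi_linear s) (phi_linear t)).
- exact: (lc _ _ (phi_linear t) (phi_linear s)).
move=> n u Pu.
have simple x z : M x z = 2%N -> phi M z (e_ (al x)) = e_ (al x).
  move=> xz; have zx : M z x = 2%N by rewrite cox_sym.
  have xnz : x != z by apply: (@M_neq _ M); rewrite xz.
  rewrite (phi_e _ (ranked1 R M x)) (inj_eq (@simple_root_inj R S)) (negPf xnz).
  by rewrite form_simple2 // eqxx.
have [->|/eqP us] := eqVneq u (al s).
  by rewrite phi_simple_self phi0 simple // phi_simple_self.
have [->|/eqP ut] := eqVneq u (al t).
  by rewrite phi_simple_self phi0 simple // phi_simple_self.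
have ns x z v : M x z = 2%N -> v <> al x -> r z v <> al x.
  move=> xz vx E; apply: vx; rewrite -(reflectionK M z v) E refl_id //.
  by rewrite form_simple2 // cox_sym.
have [k Pk _] := ranked_refl hsmall Pu us.
have [l Pl _] := ranked_refl hsmall Pu ut.
have P0 := phi_diag Pu us.
have Q0 := phi_diag Pu ut.
have Q1 := phi_diag Pk (ns _ _ _ m' ut).
have P2 := phi_diag Pl (ns _ _ _ m us).
rewrite (form_refl2 _ m') in Q1.
rewrite (form_refl2 _ m) (refl_comm _ m) in P2.
exact: (@comm_of_coefficients Qxy (pos_root M R) (phi M s) (phi M t)
  _ _ _ _ _ _ _ _ (phi_linear s) (phi_linear t) P0 Q0 Q1 P2).
Qed.

Lemma phi_simple3 s t : M s t = 3%N ->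
  phi M t (e_ (al s)) = (1 - y) *: e_ (al s) + e_ (r t (al s)).
Proof.
move=> m; have m' : M t s = 3%N by rewrite cox_sym.
have st : s != t by apply: (@M_neq _ M); rewrite m.
have ct : c t (al s) < 0 by rewrite form_simple3 //; lra.
rewrite (phi_e _ (ranked1 R M s)) (inj_eq (@simple_root_inj R S)) (negPf st).
by rewrite (lt_eqF ct) ltNge (ltW ct).
Qed.

Lemma phi_phi_simple3 s t : M s t = 3%N ->
  phi M s (phi M t (e_ (al s))) = y *: e_ (al t).
Proof.
move=> m; have m' : M t s = 3%N by rewrite cox_sym.
have ct : c t (al s) < 0 by rewrite form_simple3 //; lra.
have Pw := ranked_up (ranked1 R M s) ct.
have cw : 0 < c s (r t (al s)).
  by rewrite form_refl3 // form_simple_self form_simple3 //; lra.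
have ws : r t (al s) <> al s by exact: ranked_not_simple Pw _.
rewrite phi_simple3 // phiD phiZ phi_simple_self scaler0 add0r (phi_e _ Pw).
move/eqP/negPf: ws => ->.
by rewrite (gt_eqF cw) cw refl_refl_simple3.
Qed.

Lemma phi_simple2 s t : M s t = 2%N -> phi M t (e_ (al s)) = e_ (al s).
Proof.
move=> m; have m' : M t s = 2%N by rewrite cox_sym.
have st : s != t by apply: (@M_neq _ M); rewrite m.
rewrite (phi_e _ (ranked1 R M s)) (inj_eq (@simple_root_inj R S)) (negPf st).
by rewrite form_simple2 // eqxx.
Qed.

Lemma tau_simple s t : tau s (e_ (al t)) = if s == t then y ^+ 2 else 0.
Proof.
rewrite (tau_e _ (ranked1 R M t)) T_poly_simple //.
by case: ifP => _; rewrite ?Qy0 // exprS expr1 QyM.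
Qed.

Lemma linear_comp (W1 W2 W3 : lmodType Qxy) (f : W2 -> W3) (g : W1 -> W2) :
  linear f -> linear g -> linear (f \o g).
Proof. by move=> lf lg a v w; rewrite /= lg lf. Qed.

Lemma tau_braid s t : M s t = 3%N -> forall v,
  tau t (phi M s v) = tau s (phi M t v).
Proof.
move=> m; apply: V_linear_ext.
- exact: linear_comp (tau_linear t) (phi_linear s).
- exact: linear_comp (tau_linear s) (phi_linear t).
by move=> n u Pu; rewrite !(tau_phi _ _ Pu) (phiT_braid hsmall htri Pu m).
Qed.

Lemma tau_comm s t : M s t = 2%N -> forall v, tau s (phi M t v) = tau s v.
Proof.
move=> m; apply: V_linear_ext.
- exact: linear_comp (tau_linear s) (phi_linear t).
- exact: tau_linear.
move=> n u Pu.
by rewrite (tau_phi _ _ Pu) (phiT_comm hsmall htri Pu m) (tau_e _ Pu).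
Qed.

Lemma phi_hecke n s u : ranked n u -> u <> al s ->
  phi M s (phi M s (e_ u)) = (1 - y) *: phi M s (e_ u) + y *: e_ u.
Proof.
move=> Pu us; have [k Pk _] := ranked_refl hsmall Pu us.
have su : r s u <> al s.
  move=> E; case: (rankedN Pu) => z.
  by rewrite -(reflectionK M s u) E refl_simple_self opprK ffunE; case: eqP.
have P0 := phi_diag Pu us; have P1 := phi_diag Pk su.
rewrite reflectionK form_refl_self in P1.
apply: (@hecke_of_coefficients Qxy (pos_root M R) (phi M s) _ _ _ _ _ _ _
  (phi_linear s) P0 P1); rewrite /diag /offdiag oppr_eq0 oppr_gt0.
  by have [cs|cs|cs] := ltgtP (c s u) 0; ring.
by have [cs|cs|cs] := ltgtP (c s u) 0; ring.
Qed.

(** [phi_s] satisfies its quadratic relation at every root but [al s]; there both sides vanish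
    because [tau t] kills [e_ (al s)]. *)
Lemma tau_hecke s t : M s t = 3%N -> forall v,
  tau t (phi M s (phi M s v)) = (1 - y) * tau t (phi M s v) + y * tau t v.
Proof.
move=> m; have m' : M t s = 3%N by rewrite cox_sym.
have st : t != s by apply: (@M_neq _ M); rewrite m'.
pose f := tau t; pose P : V -> V := phi M s.
have lf : linear f := tau_linear t.
have lP : linear P := phi_linear s.
apply: (@V_linear_ext (Qxy^o) (fun v => f (P (P v)))
  (fun v => (1 - y) * f (P v) + y * f v)).
- by move=> a v w; rewrite !lP lf.
- move=> a v w; rewrite !lP !lf /GRing.scale /=; ring.
move=> n u Pu; rewrite /f /P.
have [->|/eqP us] := eqVneq u (al s).
  rewrite phi_simple_self phi0 linear_map0 // tau_simple (negPf st).
  by rewrite !mulr0 addr0.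
by rewrite (phi_hecke Pu us) tauD !tauZ.
Qed.

Lemma psi_braid s t : M s t = 3%N -> forall v : V,
  psi_gen M s (psi_gen M t (psi_gen M s v)) =
  psi_gen M t (psi_gen M s (psi_gen M t v)).
Proof.
move=> m; have m' : M t s = 3%N by rewrite cox_sym.
have st : s != t by apply: (@M_neq _ M); rewrite m.
have ts : t != s by rewrite eq_sym.
have wE : r s (al t) = r t (al s).
  by rewrite -(reflectionK M s (r t (al s))) refl_refl_simple3.
have Pt := phi_simple3 m'; rewrite wE in Pt.
have tau0 a b : a != b -> tau a (e_ (al b)) = 0.
  by move=> ab; rewrite tau_simple (negPf ab).
have tau_phi0 a b : M a b = 3%N -> tau a (phi M b (e_ (al a))) = 0.
  by move=> ab; rewrite (tau_phi _ _ (ranked1 R M a)) phiT_T_simple // Qy0.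
exact: (@braid_of_perturbation Qxy (pos_root M R) (phi M s) (phi M t)
  (psi_gen M s) (psi_gen M t) (tau s) (tau t) (e_ (al s)) (e_ (al t))
  (e_ (r t (al s))) x y (phi_linear s) (phi_linear t) (tau_linear s)
  (tau_linear t) (psi_decomp s) (psi_decomp t) (phi_braid m) Pt
  (phi_simple3 m) (phi_phi_simple3 m) (phi_phi_simple3 m') (tau0 _ _ st)
  (tau0 _ _ ts) (tau_phi0 _ _ m) (tau_phi0 _ _ m') (tau_braid m)
  (tau_hecke m) (tau_hecke m')).
Qed.

Lemma psi_comm s t : M s t = 2%N -> forall v : V,
  psi_gen M s (psi_gen M t v) = psi_gen M t (psi_gen M s v).
Proof.
move=> m; have m' : M t s = 2%N by rewrite cox_sym.
have st : s != t by apply: (@M_neq _ M); rewrite m.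
have ts : t != s by rewrite eq_sym.
have tau0 a b : a != b -> tau a (e_ (al b)) = 0.
  by move=> ab; rewrite tau_simple (negPf ab).
exact: (@comm_of_perturbation Qxy (pos_root M R) (phi M s) (phi M t)
  (psi_gen M s) (psi_gen M t) (tau s) (tau t) (e_ (al s)) (e_ (al t))
  x (phi_linear s) (phi_linear t) (tau_linear s)
  (tau_linear t) (psi_decomp s) (psi_decomp t) (phi_comm m)
  (phi_simple2 m') (phi_simple2 m) (tau0 _ _ st) (tau0 _ _ ts)
  (tau_comm m) (tau_comm m')).
Qed.

Lemma psi_simple_self s : psi_gen M s (e_ (al s)) = (x * y ^+ 2) *: e_ (al s).
Proof. by rewrite psi_decomp phi_simple_self add0r tau_simple eqxx. Qed.

Lemma psi_bijective s : bijective (psi_gen M s : V -> V).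
Proof.
pose A : V -> V := psi_gen M s.
have lA : linear A := psi_linear s.
have d0 : y * (x * y ^+ 2) != 0.
  exact: mulf_neq0 y_neq0 (mulf_neq0 x_neq0 (expf_neq0 2 y_neq0)).
have As : A (e_ (al s)) = (x * y ^+ 2) *: e_ (al s) := psi_simple_self s.
apply: (@bijective_of_quadratic Qxy (pos_root M R) A (e_ (al s)) (1 - y) y
  (x * y ^+ 2) lA d0 As) => b.
have /asboolP/(pos_rootP hsmall)[n Pb] := valP b; rewrite -e_val.
(* The quadratic relation of [phi_s] fails at [al s], but being an eigenvector of [A], [e_ (al s)]
   satisfies the required congruence trivially. *)
have [->|/eqP us] := eqVneq (val b) (al s); last first.
  exact: (@quadratic_of_perturbation Qxy (pos_root M R) (phi M s) A (tau s)
    _ _ x y (phi_linear s) (tau_linear s) (psi_decomp s) (phi_simple_self s)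
    (phi_hecke Pb us)).
exact: (@quadratic_of_eigenvector Qxy (pos_root M R) A _ _ _ _ lA As).
Qed.

End Representation.

(** * The homomorphism on the Artin monoid *)

Section ArtinRepresentation.
Variables (R : realType) (S : finType) (M : coxeterMatrix S).
Hypotheses (hsmall : small_type M) (htri : no_triangle M).

Local Notation V := (V M R).

Definition psi_GL (s : S) : GL V :=
  MkGL (@psi_linear R S M s) (psi_bijective R hsmall s).

Definition psi_word (u : seq S) : GL V :=
  foldr (fun s g => GL_mul (psi_GL s) g) (GL_one V) u.

Lemma psi_word_cat u v : psi_word (u ++ v) = GL_mul (psi_word u) (psi_word v).
Proof. by elim: u => [|s u IH]; apply: GL_eq => // w /=; rewrite IH. Qed.

Lemma psi_word_congruent u v : congruent (@artin_rel S M) u v ->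
  psi_word u = psi_word v.
Proof.
elim=> {u v} [u v [s t]|u|u v _ -> //|u v w _ -> _ -> //|u u' v v' _ E _ E'];
  last by rewrite !psi_word_cat E E'.
  have [->//|st] := eqVneq s t.
  apply: GL_eq => w; case: (hsmall st) => m; rewrite m /=.
    exact: psi_comm.
  exact: psi_braid.
by [].
Qed.

Definition psi_artin (g : artin_monoid M) : GL V := psi_word (repr g).

Lemma psi_artin_word u : psi_artin (word (@artin_rel S M) u) = psi_word u.
Proof. exact/psi_word_congruent/repr_word. Qed.

Lemma psi_artin_morphism : monoid.monoid_morphism psi_artin.
Proof.
split; first by rewrite -[LHS]/(psi_artin (word _ [::])) psi_artin_word.
move=> g h; rewrite -[LHS]/(psi_artin (word _ (repr g ++ repr h))).
by rewrite psi_artin_word psi_word_cat.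
Qed.

Lemma psi_artin_sigma s : psi_artin (sigma M s) =1 psi_gen M s.
Proof. by move=> v; rewrite psi_artin_word. Qed.

End ArtinRepresentation.

(** * Faithfulness *)

Section Specialization.

(* The value at x = 0, y = 1/2. *)
Definition special (p : {poly {poly rat}}) : rat := p.[0].[2^-1].

(** A rational function may have no value at the chosen point, so each of these predicates also
    asserts that [z] is a polynomial; it then determines [p], since [tofrac] is injective. *)
Definition special_ge0 (z : Qxy) := exists2 p, z = tofrac p & 0 <= special p.
Definition special_gt0 (z : Qxy) := exists2 p, z = tofrac p & 0 < special p.
Definition special_eq0 (z : Qxy) := exists2 p, z = tofrac p & special p = 0.

Lemma special_gt0_eq0 z : special_gt0 z -> special_eq0 z -> False.
Proof.
move=> [p -> p0] [q /eqP]; rewrite tofrac_eq => /eqP pq q0.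
by move: p0; rewrite pq q0 ltxx.
Qed.

Lemma special_gt0_ge0 z : special_gt0 z -> special_ge0 z.
Proof. by move=> [p -> /ltW p0]; exists p. Qed.

Lemma special_eq0_ge0 z : special_eq0 z -> special_ge0 z.
Proof. by move=> [p -> p0]; exists p => //; rewrite p0. Qed.

Lemma specialD p q : special (p + q) = special p + special q.
Proof. by rewrite /special !hornerD. Qed.

Lemma specialM p q : special (p * q) = special p * special q.
Proof. by rewrite /special !hornerM. Qed.

Lemma special_ge0D a b : special_ge0 a -> special_ge0 b -> special_ge0 (a + b).
Proof.
move=> [p -> p0] [q -> q0]; exists (p + q); first by rewrite tofracD.
by rewrite specialD addr_ge0.
Qed.

Lemma special_gt0D a b : special_gt0 a -> special_ge0 b -> special_gt0 (a + b).
Proof.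
move=> [p -> p0] [q -> q0]; exists (p + q); first by rewrite tofracD.
by rewrite specialD ltr_pwDl.
Qed.

Lemma special_eq0D a b : special_eq0 a -> special_eq0 b -> special_eq0 (a + b).
Proof.
move=> [p -> p0] [q -> q0]; exists (p + q); first by rewrite tofracD.
by rewrite specialD p0 q0 addr0.
Qed.

Lemma special_ge0M a b : special_ge0 a -> special_ge0 b -> special_ge0 (a * b).
Proof.
move=> [p -> p0] [q -> q0]; exists (p * q); first by rewrite tofracM.
by rewrite specialM mulr_ge0.
Qed.

Lemma special_gt0M a b : special_gt0 a -> special_gt0 b -> special_gt0 (a * b).
Proof.
move=> [p -> p0] [q -> q0]; exists (p * q); first by rewrite tofracM.
by rewrite specialM mulr_gt0.
Qed.

Lemma special_eq0M a b : special_ge0 a -> special_eq0 b -> special_eq0 (a * b).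
Proof.
move=> [p -> p0] [q -> q0]; exists (p * q); first by rewrite tofracM.
by rewrite specialM q0 mulr0.
Qed.

Lemma special_eq00 : special_eq0 0.
Proof. by exists 0; rewrite ?tofrac0 // /special !horner0. Qed.

Lemma special_ge00 : special_ge0 0.
Proof. exact/special_eq0_ge0/special_eq00. Qed.

Lemma special_gt01 : special_gt0 1.
Proof. by exists 1; rewrite ?tofrac1 // /special !hornerC. Qed.

Lemma special_natb_ge0 (b : bool) : special_ge0 b%:R.
Proof. case: b; [exact/special_gt0_ge0/special_gt01 | exact: special_ge00]. Qed.

Lemma special_gt0_y : special_gt0 y_Qxy.
Proof.
exists 'X%:P; first by [].
by rewrite /special hornerC hornerX.
Qed.

Lemma special_gt0_1y : special_gt0 (1 - y_Qxy).
Proof.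
exists (1 - 'X)%:P.
  by rewrite /y_Qxy /Qy_to_Qxy polyCB tofracB polyC1 tofrac1.
by rewrite /special hornerC hornerD hornerN hornerX hornerC; lra.
Qed.

Lemma special_eq0_x p : special_eq0 (x_Qxy * Qy_to_Qxy p).
Proof.
exists ('X * p%:P); first by rewrite tofracM.
by rewrite /special hornerM hornerX mul0r horner0.
Qed.

Lemma special_ge0_sum (I : Type) (d : seq I) (f : I -> Qxy) :
  (forall i, special_ge0 (f i)) -> special_ge0 (\sum_(i <- d) f i).
Proof.
move=> f0; elim: d => [|i d IH]; first by rewrite big_nil; exact: special_ge00.
by rewrite big_cons; exact: special_ge0D.
Qed.

Lemma special_gt0_sum (I : eqType) (d : seq I) (f : I -> Qxy) j :
  (forall i, special_ge0 (f i)) -> j \in d -> special_gt0 (f j) ->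
  special_gt0 (\sum_(i <- d) f i).
Proof.
move=> f0 jd fj; elim: d jd => // i d IH; rewrite inE big_cons.
move=> /orP[/eqP <-|jd].
  by apply: special_gt0D => //; exact: special_ge0_sum.
by rewrite addrC; apply: special_gt0D => //; exact: IH.
Qed.

Lemma special_eq0_sum (I : Type) (d : seq I) (f : I -> Qxy) :
  (forall i, special_eq0 (f i)) -> special_eq0 (\sum_(i <- d) f i).
Proof.
move=> f0; elim: d => [|i d IH]; first by rewrite big_nil; exact: special_eq00.
by rewrite big_cons; exact: special_eq0D.
Qed.

End Specialization.

(** * Supports of products of nonnegative matrices *)

Section Support.
Variable B : choiceType.
Local Notation F := {freeg B / Qxy}.

Definition nonneg (v : F) := forall b, special_ge0 (coeff b v).

Lemma coeff_linear (A : F -> F) v b : linear A ->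
  coeff b (A v) = \sum_(z <- dom v) coeff z v * coeff b (A << z >>).
Proof.
move=> lA; rewrite {1}(freeg_basisE v) linear_map_sum // raddf_sum /=.
by apply: eq_bigr => z _; rewrite coeffZ.
Qed.

Variable A : F -> F.
Hypothesis lA : linear A.
Hypothesis A_nonneg : forall z, nonneg (A << z >>).

Lemma nonneg_linear v : nonneg v -> nonneg (A v).
Proof.
move=> v0 b; rewrite coeff_linear //; apply: special_ge0_sum => z.
by apply: special_ge0M => //; exact: A_nonneg.
Qed.

(** Nonnegative entries cannot cancel, so a single positive path through [z] makes the entry
    positive. *)
Lemma gt0_linear v b z : nonneg v -> special_gt0 (coeff z v) ->
  special_gt0 (coeff b (A << z >>)) -> special_gt0 (coeff b (A v)).
Proof.
move=> v0 vz Abz; rewrite coeff_linear //; apply: (special_gt0_sum (j := z)).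
- by move=> i; apply: special_ge0M => //; exact: A_nonneg.
- rewrite mem_dom; apply/eqP => E; rewrite E in vz.
  exact: special_gt0_eq0 vz special_eq00.
- exact: special_gt0M.
Qed.

Lemma eq0_linear v b : nonneg v ->
  (forall z, special_eq0 (coeff b (A << z >>))) -> special_eq0 (coeff b (A v)).
Proof.
move=> v0 Ab; rewrite coeff_linear //; apply: special_eq0_sum => z.
exact: special_eq0M.
Qed.

Lemma basis_nonneg (z : B) : nonneg (<< z >> : F).
Proof. by move=> b; rewrite coeffU mul1r; exact: special_natb_ge0. Qed.

End Support.

(** * Recovering an element of the monoid from its matrix *)

Section Faithful.
Variables (R : realType) (S : finType) (M : coxeterMatrix S).
Hypotheses (hsmall : small_type M) (htri : no_triangle M).

Local Notation al := (simple_root R).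
Local Notation c s u := (form M (simple_root R s) u).
Local Notation r := (@reflection S M R).
Local Notation U := (rootspace S R).
Local Notation ranked := (@ranked R S M).
Local Notation V := (V M R).
Local Notation B := (pos_root M R).
Local Notation psi_word := (psi_word R hsmall).
Local Notation cong := (congruent (@artin_rel S M)).

Lemma coeff_e (b z : B) : coeff b (e_ M (val z)) = (z == b)%:R.
Proof. by rewrite e_val coeffU mul1r. Qed.

Lemma e_ranked_val n u : ranked n u -> exists b : B, val b = u.
Proof. by move=> /(e_ranked hsmall)[b bu _]; exists b. Qed.

Lemma coeff_psi s (b z : B) : coeff b (psi_gen M s (e_ M (val z))) =
  coeff b (phi M s (e_ M (val z))) +
  x_Qxy * Qy_to_Qxy (T_poly M s (val z)) * (val b == al s)%:R.
Proof.
have /asboolP/(pos_rootP hsmall)[n Pz] := valP z.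
rewrite (psi_decomp hsmall) coeffD coeffZ (tau_e hsmall s Pz).
have [a aE] := e_ranked_val (ranked1 R M s).
by rewrite -aE coeff_e val_eqE eq_sym.
Qed.

Lemma special_ge0_diag a : special_ge0 (diag (a : R)).
Proof.
rewrite /diag; case: ifP => _; first exact/special_gt0_ge0/special_gt01.
case: ifP => _; first exact: special_ge00.
exact/special_gt0_ge0/special_gt0_1y.
Qed.

Lemma special_ge0_offdiag a : special_ge0 (offdiag (a : R)).
Proof.
rewrite /offdiag; case: ifP => _; first exact: special_ge00.
case: ifP => _; first exact/special_gt0_ge0/special_gt0_y.
exact/special_gt0_ge0/special_gt01.
Qed.

Lemma special_gt0_diag a : a <= 0 -> special_gt0 (diag (a : R)).
Proof.
rewrite /diag; case: ltgtP => // _ _; first exact: special_gt0_1y.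
exact: special_gt01.
Qed.

Lemma special_gt0_offdiag a : a != 0 -> special_gt0 (offdiag (a : R)).
Proof.
rewrite /offdiag => /negPf ->; case: ifP => _; first exact: special_gt0_y.
exact: special_gt01.
Qed.

Lemma special_eq0_xT s u k :
  special_eq0 (x_Qxy * Qy_to_Qxy (T_poly M s (u : U)) * k%:R).
Proof.
rewrite mulrC; apply: special_eq0M; last exact: special_eq0_x.
elim: k => [|k IH]; first exact: special_ge00.
rewrite -addn1 natrD; apply: special_ge0D => //.
exact/special_gt0_ge0/special_gt01.
Qed.

Lemma coeff_phi s (b z w : B) : val z <> al s -> val w = r s (val z) ->
  coeff b (phi M s (e_ M (val z))) =
  diag (c s (val z)) * (z == b)%:R + offdiag (c s (val z)) * (w == b)%:R.
Proof.
move=> zs wE; have /asboolP/(pos_rootP hsmall)[n Pz] := valP z.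
by rewrite (phi_diag hsmall Pz zs) -wE coeffD !coeffZ !coeff_e.
Qed.

Lemma refl_val s (z : B) : val z <> al s -> exists w : B, val w = r s (val z).
Proof.
move=> zs; have /asboolP/(pos_rootP hsmall)[n Pz] := valP z.
have [k Pk _] := ranked_refl hsmall Pz zs.
exact: e_ranked_val Pk.
Qed.

Lemma psi_nonneg s (z : B) : nonneg (psi_gen M s << z >> : V).
Proof.
move=> b; rewrite -e_val coeff_psi; apply: special_ge0D; last first.
  exact/special_eq0_ge0/special_eq0_xT.
have [zs|/eqP zs] := eqVneq (val z) (al s).
  by rewrite zs (phi_simple_self R hsmall) coeff0; exact: special_ge00.
have [w wE] := refl_val zs; rewrite (coeff_phi _ zs wE).
by apply: special_ge0D; apply: special_ge0M; first
  [exact: special_natb_ge0 | exact: special_ge0_diag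
  | exact: special_ge0_offdiag].
Qed.

(** [al s] is not the image under [s] of a positive root and [phi_s] kills [e_ (al s)], so this row
    comes only from the perturbation, which is a multiple of x. *)
Lemma psi_row_eq0 s (a z : B) : val a = al s ->
  special_eq0 (coeff a (psi_gen M s << z >> : V)).
Proof.
move=> aE; rewrite -e_val coeff_psi; apply: special_eq0D; last first.
  exact: special_eq0_xT.
have [zs|/eqP zs] := eqVneq (val z) (al s).
  by rewrite zs (phi_simple_self R hsmall) coeff0; exact: special_eq00.
have [w wE] := refl_val zs; rewrite (coeff_phi _ zs wE).
have -> : (z == a) = false by apply/eqP => za; apply: zs; rewrite za.
have -> : (w == a) = false.
  apply/eqP => wa; have /asboolP/(pos_rootP hsmall)[n Pz] := valP z.
  case: (rankedN Pz) => q; rewrite -(reflectionK M s (val z)) -wE wa aE.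
  by rewrite refl_simple_self opprK ffunE; case: eqP.
by rewrite !mulr0 addr0; exact: special_eq00.
Qed.

Lemma psi_diag_gt0 s (z : B) : val z <> al s -> c s (val z) <= 0 ->
  special_gt0 (coeff z (psi_gen M s << z >> : V)).
Proof.
move=> zs cz; rewrite -e_val coeff_psi.
apply: special_gt0D; last exact/special_eq0_ge0/special_eq0_xT.
have [w wE] := refl_val zs; rewrite (coeff_phi _ zs wE) eqxx mulr1.
apply: special_gt0D; first exact: special_gt0_diag.
by apply: special_ge0M (special_natb_ge0 _); exact: special_ge0_offdiag.
Qed.

Lemma psi_refl_gt0 s (z w : B) : val z <> al s -> c s (val z) != 0 ->
  val w = r s (val z) -> special_gt0 (coeff w (psi_gen M s << z >> : V)).
Proof.
move=> zs cz wE; rewrite -e_val coeff_psi.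
apply: special_gt0D; last exact/special_eq0_ge0/special_eq0_xT.
rewrite (coeff_phi _ zs wE) eqxx mulr1 addrC.
apply: special_gt0D; first exact: special_gt0_offdiag.
by apply: special_ge0M (special_natb_ge0 _); exact: special_ge0_diag.
Qed.

Lemma psi_word_nonneg u (z : B) : nonneg (psi_word u << z >>).
Proof.
elim: u => [|s u IH] /=; first exact: basis_nonneg.
exact: (nonneg_linear (psi_linear s) (psi_nonneg s) IH).
Qed.

Lemma psi_word_row_eq0 s u v (a z : B) : val a = al s -> cong u (s :: v) ->
  special_eq0 (coeff a (psi_word u << z >>)).
Proof.
move=> aE /(psi_word_congruent R hsmall htri) -> /=.
apply: (eq0_linear (psi_linear s)); first exact: psi_word_nonneg.
by move=> b; exact: psi_row_eq0.
Qed.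

Lemma artin_size u v : cong u v -> size u = size v.
Proof.
elim=> {u v} [u v [s t]|//|//|u v w _ -> _ -> //|u u' v v' _ E _ E'].
  by rewrite !size_mkseq.
by rewrite !size_cat E E'.
Qed.

Definition left_divides s u := exists v, cong u (s :: v).

Lemma cong_cons s u v : cong u v -> cong (s :: u) (s :: v).
Proof.
by move=> uv; apply: (congruent_cat (congruent_refl _ [:: s]) uv).
Qed.

Lemma cong_comm s t v : M s t = 2%N -> cong (s :: t :: v) (t :: s :: v).
Proof.
move=> m; have := ArtinRel M s t; rewrite m => st.
exact: (congruent_cat (congruent_rel st) (congruent_refl _ v)).
Qed.

Lemma cong_braid s t v : M s t = 3%N ->
  cong (s :: t :: s :: v) (t :: s :: t :: v).
Proof.
move=> m; have := ArtinRel M s t; rewrite m => st.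
exact: (congruent_cat (congruent_rel st) (congruent_refl _ v)).
Qed.

Lemma psi_word_row_gt0 s u (a : B) : val a = al s -> ~ left_divides s u ->
  exists z : B, special_gt0 (coeff a (psi_word u << z >>)).
Proof.
(* The induction is on the length, for all generators at once: it is applied to the tail, and also
   to a word two letters shorter with [t] in place of [s]. *)
have [n] := ubnP (size u); elim: n => // n IH in s u a *.
case: u => [_ _ _|t u sz aE nd].
  by exists a; rewrite /= coeffU eqxx mul1r; exact: special_gt01.
have st : s != t.
  by apply/eqP => st; apply: nd; exists u; rewrite st; exact: congruent_refl.
have ast : val a <> al t.
  by rewrite aE => /simple_root_inj E; rewrite E eqxx in st.
have lift z : special_gt0 (coeff a (psi_word u << z >>)) ->
    special_gt0 (coeff a (psi_word (t :: u) << z >>)).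
  move=> az; apply: (gt0_linear (psi_linear t) (psi_nonneg t) _ az).
    exact: psi_word_nonneg.
  apply: psi_diag_gt0 => //; rewrite aE; apply: form_simple_le0 => //.
  by rewrite eq_sym.
have [[v uv]|ndu] := pselect (left_divides s u); last first.
  have [z az] := IH s u a sz aE ndu.
  by exists z; exact: lift.
have [m|m] := hsmall st.
  case: nd; exists (t :: v); apply: congruent_trans (cong_cons t uv) _.
  by apply: cong_comm; rewrite cox_sym.
have m' : M t s = 3%N by rewrite cox_sym.
(* Otherwise the word would begin with [t s t], hence be congruent to one beginning with [s t s]. *)
have ndv : ~ left_divides t v.
  move=> [w vw]; apply: nd; exists (t :: s :: w).
  apply: congruent_trans (cong_cons t uv) _.
  apply: congruent_trans (cong_cons t (cong_cons s vw)) _.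
  exact: cong_braid.
have [b bE] := e_ranked_val (ranked1 R M t).
have szv : (size v < n)%N by move: sz; rewrite /= (artin_size uv) /=; lia.
have [z bz] := IH t v b szv bE ndv.
have bs : val b <> al s by rewrite bE => /simple_root_inj E; rewrite E eqxx in st.
(* [d] is the root [al s + al t], the intermediate point of the positive path from [al t] by [psi_s]
   to [d] and by [psi_t] to [al s]. *)
have [d dE] := refl_val bs.
exists z; have E : psi_word (t :: u) = psi_word [:: t, s & v].
  by apply: (psi_word_congruent R hsmall htri); exact: cong_cons.
rewrite E /=.
apply: (gt0_linear (z := d) (psi_linear t) (psi_nonneg t)).
- exact: (nonneg_linear (psi_linear s) (psi_nonneg s) (psi_word_nonneg _ _)).
- apply: (gt0_linear (psi_linear s) (psi_nonneg s) (psi_word_nonneg _ _) bz).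
  apply: psi_refl_gt0 => //; rewrite bE form_simple3 //.
  by rewrite oppr_eq0 oner_eq0.
- apply: psi_refl_gt0; last 1 first.
  + by rewrite dE bE refl_refl_simple3 // aE.
  + have ct : c s (al t) < 0 by rewrite form_simple3 //; lra.
    rewrite dE bE.
    exact: (ranked_not_simple hsmall (ranked_up (ranked1 R M t) ct)).
  + rewrite dE bE form_refl3 // form_simple_self form_simple3 //.
    by apply/eqP; lra.
Qed.

Lemma psi_word_inj u v : psi_word u = psi_word v -> cong u v.
Proof.
elim: u v => [|s u IH] v uv.
  case: v uv => [|s v] uv; first exact: congruent_refl.
  (* The diagonal entry at [al s] is 1 for the identity but specialises to 0 for [s :: v], so no
     nonempty word acts as the identity. *)
  have [a aE] := e_ranked_val (ranked1 R M s); exfalso.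
  have := psi_word_row_eq0 a aE (congruent_refl _ (s :: v)).
  rewrite -uv /= coeffU eqxx mul1r; exact: special_gt0_eq0 special_gt01.
have [a aE] := e_ranked_val (ranked1 R M s).
(* The row of [al s] specialises to zero for [s :: u], hence also for [v], which forces [s] to
   divide [v]. *)
have [[w vw]|nd] := pselect (left_divides s v); last first.
  have [z az] := psi_word_row_gt0 aE nd; exfalso.
  apply: special_gt0_eq0 az _; rewrite -uv.
  exact: psi_word_row_eq0 aE (congruent_refl _ _).
apply: congruent_trans (congruent_sym vw); apply/cong_cons/IH.
(* Invertibility of [psi_s] cancels the common first letter. *)
apply: GL_eq => q; apply: (bij_inj (psi_bijective R hsmall s)).
have := congr1 (fun g : GL V => g q) uv.
by rewrite (psi_word_congruent R hsmall htri vw).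
Qed.

Lemma psi_artin_inj : injective (psi_artin R hsmall).
Proof.
move=> g h /psi_word_inj gh.
by rewrite -(word_repr g) -(word_repr h); apply/wordP.
Qed.

End Faithful.

(* GRing.Theory hides the monoid morphisms with those of semirings. *)
Import monoid.

Theorem theorem4p1 (R : realType) (S : finType) (M : coxeterMatrix S)
    (hsmall : small_type M) (htri : no_triangle M) :
  exists psi : artin_monoid M -> GL (V M R),
    [/\ monoid_morphism psi,
        forall s, psi (sigma M s) =1 psi_gen M s
      & injective psi].
Proof.
exists (psi_artin R hsmall); split.
- exact: psi_artin_morphism.
- by move=> s; exact: psi_artin_sigma.
- exact: psi_artin_inj.
Qed.
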